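(* Let $n\ge1$. The hyperplane arrangement $\{H_A\}_{A\in\mathcal{H}_n}$ is locally finite in $\mathcal{C}_n$. Moreover, if $\delta\in\partial\mathcal{C}_n$ (corresponding to the class $\omega_\delta=L-\sum_i\delta_iE_i$) is an accumulation point of a sequence of hyperplanes of this arrangement, then it belongs to the round boundary $\sum_i\delta_i^2=1$, on which the symplectic volume vanishes.
   Context: $\mathbb{C}\mathrm{P}^2$ carries the Fubini–Study form normalized so that a line has area $1$. $\mathcal{C}_n\subset\mathbb{R}^n$ is the set of admissible capacities: $n$-tuples $\delta=(\delta_1,\ldots,\delta_n)$ of positive numbers such that the disjoint union of standard closed balls $B^4(\delta_i)$ of capacity $\delta_i=\pi r_i^2$ embeds symplectically in $\mathbb{C}\mathrm{P}^2$; it is open. $\widetilde M_n=\mathbb{C}\mathrm{P}^2\#n\overline{\mathbb{C}\mathrm{P}}^2$ with line class $L$ and exceptional classes $E_i$; $\mathbb{R}^n$ is viewed in $H_2(\widetilde M_n;\mathbb{R})$ via $\delta\mapsto\omega_\delta=L-\sum_i\delta_iE_i$ (Poincaré dual of the blow-up form). $K_n=-3L+\sum_iE_i$. $\mathcal{H}_n$ is the set of integral classes $A=a_0L-\sum_ia_iE_i$ with $a_i\ge0$ for $i=0,\ldots,n$, $A^2=a_0^2-\sum_{i\ge1}a_i^2<0$, and $-2\le A^2+K_n\cdot A$. $H_A$ is the hyperplane $\omega\cdot A=0$, i.e. $a_0-\sum_ia_i\delta_i=0$. An accumulation point of hyperplanes is a point every neighbourhood of which meets infinitely many distinct hyperplanes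 of the arrangement. *)

(* Defs.v *)
From HB Require Import structures.
From mathcomp Require Import all_boot all_order all_algebra.
From mathcomp Require Import complex.
From mathcomp Require Import all_classical all_reals all_analysis.

Set Implicit Arguments.
Unset Strict Implicit.
Unset Printing Implicit Defensive.

Import Order.TTheory GRing.Theory Num.Theory.
Import numFieldNormedType.Exports.

Local Open Scope classical_set_scope.
Local Open Scope ring_scope.

Section SymplecticBalls.
Context {R : realType}.
Implicit Types (x u v : 'rV[R]_4) (U V : set 'rV[R]_4).

(* For an open U this is C^infinity regularity on U. *)
Definition smooth_on U (g : 'rV[R]_4 -> R) : Prop :=
  forall (s : seq 'rV[R]_4) x, U x ->
    differentiable (foldr (fun v (h : 'rV[R]_4 -> R) => 'D_v h) g s) x.

(* R^4 has the coordinates (x_1, y_1, x_2, y_2):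
   omega_0 = dx_1 /\ dy_1 + dx_2 /\ dy_2. *)
Definition omega0 u v : R :=
  (u 0 (inord 0) * v 0 (inord 1) - u 0 (inord 1) * v 0 (inord 0)) +
  (u 0 (inord 2) * v 0 (inord 3) - u 0 (inord 3) * v 0 (inord 2)).

(* B^4(c), the closed ball of capacity c = pi r^2. *)
Definition closed_ball4 (c : R) : set 'rV[R]_4 :=
  [set x : 'rV[R]_4 | pi * (\sum_i x 0 i ^+ 2) <= c].

Definition CP2 : Type := {P : {vspace 'rV[R[i]]_3} | \dim P == 1%N}.

Definition affine_dom (k : 'I_3) (P : CP2) : Prop := vpick (val P) 0 k != 0.

(* The standard chart {z_k <> 0} of CP^2, whose target C^2 is realized as the
   affine plane {z | z_k = 1} of C^3: it sends [z] to z / z_k. *)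
Definition affine_coord (k : 'I_3) (P : CP2) : 'rV[R[i]]_3 :=
  (vpick (val P) 0 k)^-1 *: vpick (val P).

Definition hdot (z w : 'rV[R[i]]_3) : R[i] := \sum_j conjc (z 0 j) * w 0 j.

(* The pullback (i / 2 pi) ddbar log |z|^2 to C^3 \ {0} of the Fubini-Study
   form, normalized so that a complex line has area 1. *)
Definition fubini_study (z u v : 'rV[R[i]]_3) : R :=
  complex.Im ((hdot z z * hdot u v - hdot u z * hdot z v) / hdot z z ^+ 2) / pi.

Definition smooth_at (f : 'rV[R]_4 -> CP2) x : Prop :=
  exists (k : 'I_3) V, [/\ open V, V x, forall y, V y -> affine_dom k (f y) &
    forall j : 'I_3,
      smooth_on V (fun y => complex.Re (affine_coord k (f y) 0 j)) /\
      smooth_on V (fun y => complex.Im (affine_coord k (f y) 0 j))].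

(* The directional derivative of f at x along u, in the k-th chart. *)
Definition deriv_chart (f : 'rV[R]_4 -> CP2) (k : 'I_3) x u : 'rV[R[i]]_3 :=
  \row_(j < 3)
    Complex ('D_u (fun y => complex.Re (affine_coord k (f y) 0 j)) x)
            ('D_u (fun y => complex.Im (affine_coord k (f y) 0 j)) x).

Definition symplectic_at (f : 'rV[R]_4 -> CP2) x : Prop :=
  forall k : 'I_3, affine_dom k (f x) -> forall u v,
    fubini_study (affine_coord k (f x))
      (deriv_chart f k x u) (deriv_chart f k x v) = omega0 u v.

(* Only the values of f i near the i-th ball matter: each f i is smooth on a
   neighbourhood of this ball.  A smooth injective map of a compact manifold
   that preserves the symplectic forms is an immersion, hence an embedding. *)
Definition symplectic_ball_embedding n (delta : 'rV[R]_n)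
    (f : 'I_n -> 'rV[R]_4 -> CP2) : Prop :=
  (forall i x, closed_ball4 (delta 0 i) x ->
     smooth_at (f i) x /\ symplectic_at (f i) x) /\
  (forall i j x y, closed_ball4 (delta 0 i) x -> closed_ball4 (delta 0 j) y ->
     f i x = f j y -> i = j /\ x = y).

Definition admissible n : set 'rV[R]_n :=
  [set delta : 'rV[R]_n | (forall i, 0 < delta 0 i) /\
               exists f, symplectic_ball_embedding delta f].

End SymplecticBalls.

(* H_2 of the n-fold blow-up of CP^2 with coefficients in Z: the pair (a0, a)
   is the class a0 L - \sum_i a_i E_i. *)
Definition H2 (Z : comNzRingType) (n : nat) : Type := (Z * 'rV[Z]_n)%type.

(* L . L = 1, E_i . E_i = -1, and distinct elements of the basis are
   orthogonal. *)
Definition intersection (Z : comNzRingType) n (A B : H2 Z n) : Z :=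
  A.1 * B.1 - \sum_i A.2 0 i * B.2 0 i.

(* K_n = -3 L + \sum_i E_i *)
Definition canonical_class n : H2 int n := (- 3, const_mx (- 1)).

Definition H2_real (R : realType) n (A : H2 int n) : H2 R n :=
  (A.1%:~R, map_mx intr A.2).

Definition omega_class (R : realType) n (delta : 'rV[R]_n) : H2 R n :=
  (1, delta).

(* \int omega^2 / 2 *)
Definition symplectic_volume (R : realType) n (w : H2 R n) : R :=
  intersection w w / 2.

Definition calH n : set (H2 int n) :=
  [set A : H2 int n | [/\ 0 <= A.1, forall i, 0 <= A.2 0 i, intersection A A < 0 &
               - 2 <= intersection A A + intersection (canonical_class n) A]].

Definition hyperplane (R : realType) n (A : H2 int n) : set 'rV[R]_n :=
  [set delta : 'rV[R]_n | intersection (omega_class delta) (H2_real R A) = 0].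

Definition locally_finite_in (T : topologicalType) (I : Type) (D : set I)
    (H : I -> set T) (C : set T) : Prop :=
  forall x, C x -> exists2 V, nbhs x V &
    finite_set [set i | D i /\ H i `&` V !=set0].

Definition accumulation_point (T : topologicalType) (arr : set (set T))
    (x : T) : Prop :=
  forall V, nbhs x V -> infinite_set [set P | arr P /\ P `&` V !=set0].

Definition frontier (T : topologicalType) (C : set T) : set T :=
  closure C `\` interior C.

(* Main.v *)
(** Everything reduces to the volume constraint: an admissible capacity vector
    satisfies [\sum_i delta_i^2 < 1].  Indeed, where [\sum_i delta_i^2 <= 1 - q]
    with [q > 0], Cauchy-Schwarz makes the orthogonal of [omega_delta] uniformly
    negative definite, and [-2 <= A^2 + K.A] leaves only finitely many classes [A]
    with [omega_delta . A = 0]; and on the closure of the admissible set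
    [\sum_i delta_i^2 <= 1], so an accumulation point there lies on the sphere.

    The volume constraint is proved without measure theory, with the inner
    content of a subset of R^n: the supremum of the total volume of finitely many
    disjoint open cubes inside it.  It is superadditive by construction.  A linear
    map [T] multiplies it by at least [|det T|]: this expansion factor is
    supermultiplicative, it is invariant under conjugation of a shear by a
    dilation, hence equal to the factor of arbitrarily small shears, and the LUP
    decomposition does the rest.  A C^1 map is locally close to its derivative,
    so by compactness an injective symplectic map does not decrease the content
    of cubes.  Finally CP^2 minus a line is symplectomorphic to the open ball of
    capacity 1; the points sent to the line are covered by a negligible fraction
    of the cells of a fine grid.  Strictness comes from a small cube next to a
    boundary point of one of the balls, whose image avoids all the balls. *)
Require Import Defs.
From mathcomp Require Import all_boot all_order all_algebra perm.
From mathcomp Require Import ring lra complex.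
From mathcomp Require Import all_classical all_reals all_analysis.
Import numFieldNormedType.Exports.
Import Order.TTheory GRing.Theory Num.Theory.

Set Implicit Arguments.
Unset Strict Implicit.
Unset Printing Implicit Defensive.

Local Open Scope classical_set_scope.
Local Open Scope ring_scope.

(** Every estimate on an image is a lower bound: the images lie in the ball of capacity 1 and are
    compared with the supremum of its own packings. So superadditivity suffices, and neither
    measurability nor an equality of change of variables is needed; the one upper bound is that this
    supremum is finite. Rescaled by [sqrt d], the same ball is also the source, so its volume is a
    common unit and the factor [d ^+ 2] appears directly. Two obstacles shape the rest. No affine
    chart contains all the images, hence the set [A] of points sent into the chart, which
    accompanies the volume estimates: a cube may lose its points outside [A] provided its image
    keeps almost all its content. And [CP2] is a bare type without topology, so openness and
    separation are read off from coordinates. *)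

Lemma one_sub_expn {R : realDomainType} (e : R) (m : nat) : 0 <= e <= 1 ->
  1 - m%:R * e <= (1 - e) ^+ m.
Proof.
move=> /andP[e0 e1]; elim: m => [|m IH]; first by rewrite mul0r subr0 expr0.
have : (1 - m%:R * e) * (1 - e) <= (1 - e) ^+ m * (1 - e) by rewrite ler_wpM2r// subr_ge0.
rewrite -exprSr; apply: le_trans; rewrite -natr1.
have : 0 <= m%:R * e * e by rewrite !mulr_ge0.
by lra.
Qed.

(** * Inner content through packings by disjoint cubes *)

Section Packing.
Context {R : realType} {n : nat}.
Implicit Types (S A : set 'rV[R]_n) (x y z c : 'rV[R]_n) (r s t : R).

Lemma rV_norm_lt x r : 0 < r -> (`|x| < r) <-> (forall i, `|x 0 i| < r).
Proof.
move=> r0; rewrite /Num.norm /= mx_normrE; split=> [/bigmax_ltP[_ h] i|h].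
  exact: (h (0, i) isT).
by apply/bigmax_ltP; split=> // ij _; rewrite [ij.1]ord1; exact: h.
Qed.

Lemma rV_norm_le x r : 0 <= r -> (`|x| <= r) <-> (forall i, `|x 0 i| <= r).
Proof.
move=> r0; rewrite /Num.norm /= mx_normrE; split=> [/bigmax_leP[_ h] i|h].
  exact: (h (0, i) isT).
by apply/bigmax_leP; split=> // ij _; rewrite [ij.1]ord1; exact: h.
Qed.

Lemma rV_coord_le x i : `|x 0 i| <= `|x|.
Proof. by move: i; apply/rV_norm_le. Qed.

Lemma cubeP c r y : 0 < r -> ball c r y <-> (forall i, `|c 0 i - y 0 i| < r).
Proof.
move=> r0; rewrite -ball_normE /ball_ /= rV_norm_lt//.
by split=> h i; have := h i; rewrite !mxE.
Qed.

(* The total weight of a finite family of disjoint open cubes of [S]; a cube of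
   side 2r has weight r^n. *)
Inductive packed : set 'rV[R]_n -> R -> Prop :=
| packed0 S : packed S 0
| packed_cube S c r : 0 < r -> ball c r `<=` S -> packed S (r ^+ n)
| packed_cat S S1 S2 t1 t2 : S1 `<=` S -> S2 `<=` S -> S1 `&` S2 = set0 ->
    packed S1 t1 -> packed S2 t2 -> packed S (t1 + t2).

(** The inequality between [t] and the supremum of the packed weights, phrased so that this supremum
    need not be finite. Approximation from below makes it stable under increasing limits in [t],
    which absorbs every loss factor [1 - e]. *)
Definition vol_ge S t := forall t', t' < t -> exists2 s, t' < s & packed S s.

Lemma packedS S S' t : S `<=` S' -> packed S t -> packed S' t.
Proof.
move=> SS' h; elim: h S' SS' => {S t} [S S' _|S c r r0 cS S' SS'|].
- exact: packed0.
- by apply: packed_cube r0 _; exact: subset_trans cS SS'.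
move=> S S1 S2 t1 t2 s1 s2 s12 p1 _ p2 _ S' SS'.
by apply: packed_cat s12 p1 p2; [exact: subset_trans s1 SS'|exact: subset_trans s2 SS'].
Qed.

Lemma vol_geS S S' t : S `<=` S' -> vol_ge S t -> vol_ge S' t.
Proof. by move=> SS' h t' /h[s ts p]; exists s => //; exact: packedS p. Qed.

Lemma vol_ge_le S s t : s <= t -> vol_ge S t -> vol_ge S s.
Proof. by move=> st h t' /lt_le_trans/(_ st)/h. Qed.

Lemma packed_vol_ge S t : packed S t -> vol_ge S t.
Proof. by move=> p t' tt'; exists t. Qed.

Lemma vol_ge0 S : vol_ge S 0.
Proof. exact/packed_vol_ge/packed0. Qed.

Lemma vol_ge_closed S t : (forall t', t' < t -> vol_ge S t') -> vol_ge S t.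
Proof.
move=> h t' tt'; have t1 : (t' + t) / 2 < t by lra.
have t2 : t' < (t' + t) / 2 by lra.
exact: h _ t1 _ t2.
Qed.

Lemma vol_ge_cat S S1 S2 t1 t2 : S1 `<=` S -> S2 `<=` S -> S1 `&` S2 = set0 ->
  vol_ge S1 t1 -> vol_ge S2 t2 -> vol_ge S (t1 + t2).
Proof.
move=> s1 s2 s12 h1 h2 t' tt'; set e := (t1 + t2 - t') / 2.
have [|u1 ue1 p1] := h1 (t1 - e); first by rewrite /e; lra.
have [|u2 ue2 p2] := h2 (t2 - e); first by rewrite /e; lra.
exists (u1 + u2); first by move: ue1 ue2; rewrite /e; lra.
exact: packed_cat p1 p2.
Qed.

Lemma vol_ge_seq (I : eqType) (r : seq I) (P : pred I) (Si : I -> set 'rV[R]_n)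
    (t : I -> R) :
  uniq r -> (forall i j, P i -> P j -> i != j -> Si i `&` Si j = set0) ->
  (forall i, i \in r -> P i -> vol_ge (Si i) (t i)) ->
  vol_ge (\bigcup_(i in [set i | (i \in r) && P i]) Si i) (\sum_(i <- r | P i) t i).
Proof.
elim: r => [|i r IH] /= u dis h; first by rewrite big_nil; exact: vol_ge0.
have /andP[ir ur] := u; rewrite big_cons; case: ifPn => Pi; last first.
  apply: vol_geS (IH ur dis _) => [y [j /= /andP[jr Pj] yj]|j jr]; last first.
    by apply: h; rewrite inE jr orbT.
  by exists j => //=; rewrite inE jr Pj orbT.
apply: (@vol_ge_cat _ (Si i) (\bigcup_(i in [set i | (i \in r) && P i]) Si i)).
- by move=> y yi; exists i => //=; rewrite inE eqxx.
- by move=> y [j /= /andP[jr Pj] yj]; exists j => //=; rewrite inE jr Pj orbT.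
- rewrite -subset0 => y [yi [j /= /andP[jr Pj] yj]].
  have ij : i != j by apply: contra ir => /eqP ->.
  have : (Si i `&` Si j) y by [].
  by rewrite dis.
- by apply: h; rewrite ?inE ?eqxx.
by apply: IH => // j jr; apply: h; rewrite inE jr orbT.
Qed.

Lemma vol_ge_sum (I : finType) (P : pred I) (Si : I -> set 'rV[R]_n) (t : I -> R) S :
  (forall i j, P i -> P j -> i != j -> Si i `&` Si j = set0) ->
  (forall i, P i -> Si i `<=` S) -> (forall i, P i -> vol_ge (Si i) (t i)) ->
  vol_ge S (\sum_(i | P i) t i).
Proof.
move=> dis sub h; apply: (@vol_geS (\bigcup_(i in [set i | P i]) Si i)).
  by move=> y [i /= Pi]; exact: sub.
have -> : [set i | P i] = [set i | (i \in index_enum I) && P i].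
  by apply/seteqP; split=> i /=; rewrite mem_index_enum.
apply: vol_ge_seq => //; last by move=> i _; exact: h.
exact: index_enum_uniq.
Qed.

(** A bound on the images of cubes passes to packings because disjoint pieces keep disjoint images
    and content is superadditive. The set-valued [g] attaches to a base point the points to be
    mapped, possibly none; this is how [vol_ge_image] discards what lies outside [A]. *)
Lemma packed_image (T : Type) (f : T -> 'rV[R]_n) (g : 'rV[R]_n -> set T) (S0 : set 'rV[R]_n)
    (k : R) : 0 <= k ->
  (forall y z u v, S0 y -> S0 z -> g y u -> g z v -> f u = f v -> y = z) ->
  (forall c r, 0 < r -> ball c r `<=` S0 ->
     vol_ge (f @` \bigcup_(y in ball c r) g y) (k * r ^+ n)) ->
  forall S t, vol_ge S t -> S `<=` S0 -> vol_ge (f @` \bigcup_(y in S) g y) (k * t).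
Proof.
move=> k0 inj h.
have hp S t : packed S t -> S `<=` S0 -> vol_ge (f @` \bigcup_(y in S) g y) (k * t).
  elim=> {S t} [S _|S c r r0 cS SS0|S S1 S2 t1 t2 s1 s2 s12 p1 h1 p2 h2 SS0].
  - by rewrite mulr0; exact: vol_ge0.
  - apply: (vol_geS _ (h c r r0 (subset_trans cS SS0))).
    by apply: image_subset; exact: bigcup_subset.
  rewrite mulrDr; apply: vol_ge_cat (h1 _) (h2 _).
  - by apply: image_subset; exact: bigcup_subset.
  - by apply: image_subset; exact: bigcup_subset.
  - rewrite -subset0 => _ [[u [y y1 yu] <-] [v [z z2 zv] uv]].
    have yz : y = z by apply: inj yu zv _ => //; [exact/SS0/s1|exact/SS0/s2].
    have : (S1 `&` S2) y by split; rewrite // yz.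
    by rewrite s12.
  - exact: subset_trans s1 SS0.
  - exact: subset_trans s2 SS0.
move=> S t vt SS0; have [->|k1] := eqVneq k 0.
  by rewrite mul0r; exact: vol_ge0.
have kp : 0 < k by rewrite lt_def k1.
apply: vol_ge_closed => t' tt'.
have [|s ts ps] := vt (t' / k); first by rewrite ltr_pdivrMr// mulrC.
apply: vol_ge_le (hp _ _ ps SS0).
by rewrite ltW// mulrC -ltr_pdivrMr.
Qed.

Lemma vol_ge_image (f : 'rV[R]_n -> 'rV[R]_n) (S0 A : set 'rV[R]_n) (k : R) : 0 <= k ->
  (forall y z, S0 y -> S0 z -> A y -> A z -> f y = f z -> y = z) ->
  (forall c r, 0 < r -> ball c r `<=` S0 -> vol_ge (f @` (ball c r `&` A)) (k * r ^+ n)) ->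
  forall S t, vol_ge S t -> S `<=` S0 -> vol_ge (f @` (S `&` A)) (k * t).
Proof.
move=> k0 inj h S t vt SS0.
have E B : f @` (B `&` A) = f @` \bigcup_(y in B) ([set y] `&` A).
  congr (_ @` _); apply/seteqP; split=> [y [By Ay]|y [z Bz [-> Az]]//].
  by exists y.
rewrite E; apply: (@packed_image _ f (fun y => [set y] `&` A) S0) vt SS0 => //.
  by move=> y z _ _ S0y S0z [-> Ay] [-> Az]; exact: inj.
by move=> c r r0 cr; rewrite -E; exact: h.
Qed.

Lemma affine_cube c c' r s : 0 < s ->
  [set c' + s *: x | x in ball c r] = ball (c' + s *: c) (s * r).
Proof.
move=> s0; apply/seteqP; split=> [_ [x + <-]|y]; rewrite -!ball_normE /ball_ /=.
  move=> cx; rewrite opprD addrACA subrr add0r -scalerBr normrZ gtr0_norm//.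
  by rewrite ltr_pM2l.
move=> h; exists (s^-1 *: (y - c')); last first.
  by rewrite scalerA mulfV ?gt_eqF// scale1r addrC subrK.
rewrite -(ltr_pM2l s0) -{1}(gtr0_norm s0) -normrZ scalerBr scalerA mulfV ?gt_eqF//.
by rewrite scale1r opprB addrA [s *: c + c']addrC.
Qed.

Lemma vol_ge_affine c s S t : 0 < s -> vol_ge S t ->
  vol_ge [set c + s *: x | x in S] (s ^+ n * t).
Proof.
move=> s0 vt; rewrite -[S]setIT.
apply: (@vol_ge_image _ setT) => //; first by rewrite exprn_ge0// ltW.
  by move=> y z _ _ _ _ /addrI/scalerI; apply; rewrite gt_eqF.
move=> c' r r0 _; rewrite setIT affine_cube// -exprMn.
apply: packed_vol_ge.
exact: packed_cube (mulr_gt0 s0 r0) (@subset_refl _ _).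
Qed.

End Packing.
Arguments packed {R n}.
Arguments vol_ge {R n}.

(** * Volume expansion of linear maps *)

Section Expansion.
Context {R : realType} {n : nat}.
Implicit Types (T U : 'M[R]_n) (x y l : 'rV[R]_n) (i j : 'I_n).

(** The unit cube has weight 1, so [k] is a lower bound for the factor by which [T], acting on row
    vectors, multiplies content. *)
Definition expands T (k : R) :=
  vol_ge [set x *m T | x in (ball (0 : 'rV[R]_n) 1)] k.

Lemma ball01P x : ball (0 : 'rV[R]_n) 1 x <-> (forall i, `|x 0 i| < 1).
Proof. by rewrite cubeP//; split=> h i; have := h i; rewrite mxE sub0r normrN. Qed.

Lemma expands_le T (l k : R) : l <= k -> expands T k -> expands T l.
Proof. exact: vol_ge_le. Qed.

Lemma expands_cube T k (c : 'rV[R]_n) (r : R) : 0 < r -> expands T k ->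
  vol_ge [set x *m T | x in ball c r] (k * r ^+ n).
Proof.
move=> r0 /(vol_ge_affine (c *m T) r0); rewrite mulrC; apply: vol_geS.
move=> _ [_ [x x1 <-] <-]; exists (c + r *: x); last by rewrite mulmxDl scalemxAl.
rewrite -[r in ball c r]mulr1 -[c in ball c]addr0 -(scaler0 _ r) -affine_cube//.
by exists x.
Qed.

Lemma expandsM T U k (l : R) : expands T k -> expands U l -> U \in unitmx -> 0 <= l ->
  expands (T *m U) (l * k).
Proof.
move=> Tk Ul Uu l0.
have := @vol_ge_image R n (fun x => x *m U) setT setT l l0 _ _ _ _ Tk _.
rewrite setIT image_comp (_ : _ \o _ = fun x => x *m (T *m U)); last first.
  by apply/funext => x; rewrite /= mulmxA.
apply=> //; first by move=> y z _ _ _ _ /(can_inj (mulmxK Uu)).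
by move=> c r r0 _; rewrite setIT; exact: expands_cube.
Qed.

(** The hypothesis keeps the preimage of the unit cube inside the unit cube, so the image contains a
    cube of weight 1. It covers permutations of the coordinates and sign changes. *)
Lemma expands_isometry T : T \in unitmx ->
  (forall x i, exists j, `|(x *m invmx T) 0 i| = `|x 0 j|) -> expands T 1.
Proof.
move=> Tu h; apply: packed_vol_ge; rewrite -[X in packed _ X](expr1n _ n).
apply: (@packed_cube _ _ _ 0) => // x /ball01P x1; exists (x *m invmx T).
  by apply/ball01P => i; have [j ->] := h x i.
exact: mulmxKV.
Qed.

Definition scale_mx i (a : R) : 'M[R]_n := diag_mx (\row_j if j == i then a else 1).

Lemma mul_scale_mx i a x : x *m scale_mx i a = \row_j (if j == i then x 0 j * a else x 0 j).
Proof. by apply/rowP => j; rewrite mul_mx_diag !mxE; case: eqP; rewrite ?mulr1. Qed.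

Lemma scale_mxM i a b : scale_mx i a *m scale_mx i b = scale_mx i (a * b).
Proof.
rewrite mulmx_diag; congr diag_mx; apply/rowP => j; rewrite !mxE.
by case: eqP; rewrite ?mulr1.
Qed.

Lemma scale_mx1 i : scale_mx i 1 = 1%:M.
Proof. by apply/matrixP => j k; rewrite !mxE if_same. Qed.

Lemma scale_mxV i a : a != 0 -> scale_mx i a *m scale_mx i a^-1 = 1%:M.
Proof. by move=> a0; rewrite scale_mxM mulfV// scale_mx1. Qed.

Lemma scale_mx_unit i a : a != 0 -> scale_mx i a \in unitmx.
Proof. by move=> /(scale_mxV i)/mulmx1_unit[]. Qed.

Lemma expands1 : expands 1%:M 1.
Proof.
by apply: expands_isometry; rewrite ?unitmx1// => x i; exists i; rewrite invmx1 mulmx1.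
Qed.

(** The slab of half-width [a + b] in direction [i] is cut at [a - b] into slabs of half-widths [a]
    and [b], centred at [- b] and [a]; superadditivity adds their contents. *)
Lemma expands_scaleD i a b : 0 < a -> 0 < b -> expands (scale_mx i a) a ->
  expands (scale_mx i b) b -> expands (scale_mx i (a + b)) (a + b).
Proof.
move=> a0 b0 ha hb.
have shift (v : R) c t : 0 < c -> expands (scale_mx i c) t ->
    vol_ge [set y : 'rV[R]_n | (forall j, j != i -> `|y 0 j| < 1) /\ `|y 0 i - v| < c] t.
  move=> c0 /(vol_ge_affine (v *: delta_mx 0 i) ltr01); rewrite expr1n mul1r.
  apply: vol_geS => _ [_ [x /ball01P x1 <-] <-] /=; rewrite scale1r.
  rewrite mul_scale_mx; split=> [j ji|]; rewrite !mxE !eqxx ?(negbTE ji)/=.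
    by rewrite mulr0 add0r.
  by rewrite mulr1 addrAC subrr add0r normrM (gtr0_norm c0) gtr_pMl.
apply: vol_ge_cat (shift (- b) a a a0 ha) (shift a b b b0 hb).
- move=> y /= [yj]; rewrite ltr_norml => /andP[y1 y2]; exists (y *m scale_mx i (a + b)^-1).
    apply/ball01P => j; rewrite mul_scale_mx !mxE; case: ifPn => [/eqP ->|]; last exact: yj.
    rewrite normrM normfV (gtr0_norm (addr_gt0 a0 b0)) ltr_pdivrMr ?addr_gt0// mul1r.
    by rewrite ltr_norml; lra.
  by rewrite -mulmxA scale_mxM mulVf ?scale_mx1 ?mulmx1// gt_eqF// addr_gt0.
- move=> y /= [yj]; rewrite ltr_norml => /andP[y1 y2]; exists (y *m scale_mx i (a + b)^-1).
    apply/ball01P => j; rewrite mul_scale_mx !mxE; case: ifPn => [/eqP ->|]; last exact: yj.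
    rewrite normrM normfV (gtr0_norm (addr_gt0 a0 b0)) ltr_pdivrMr ?addr_gt0// mul1r.
    by rewrite ltr_norml; lra.
  by rewrite -mulmxA scale_mxM mulVf ?scale_mx1 ?mulmx1// gt_eqF// addr_gt0.
rewrite -subset0 => y /= [[_ +] [_]]; rewrite !ltr_norml => /andP[y1 y2] /andP[y3 y4].
by move: y1 y2 y3 y4; lra.
Qed.

Lemma expands_scale_nat i m : expands (scale_mx i m.+1%:R) m.+1%:R.
Proof.
elim: m => [|m IH]; first by rewrite scale_mx1; exact: expands1.
by rewrite -addn1 natrD; apply: expands_scaleD => //; rewrite scale_mx1; exact: expands1.
Qed.

Lemma expands_scalar (s : R) : 0 < s -> expands s%:M (s ^+ n).
Proof.
move=> s0; apply: packed_vol_ge; apply: (@packed_cube _ _ _ 0) => // x.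
rewrite cubeP// => xs; exists (s^-1 *: x); last first.
  by rewrite mul_mx_scalar scalerA mulfV ?gt_eqF// scale1r.
apply/ball01P => i; have := xs i; rewrite !mxE sub0r normrN normrM normfV (gtr0_norm s0).
by rewrite mulrC ltr_pdivrMr// mul1r.
Qed.

(** Superadditivity gives integer factors but no division. Halving one coordinate is therefore
    obtained by doubling the other [n - 1] coordinates and then shrinking everything by 2: the
    factor is [2 ^ (n - 1) / 2 ^ n]. *)
Lemma expands_scale_half i : expands (scale_mx i 2^-1) 2^-1.
Proof.
pose d (r : seq 'I_n) : 'rV[R]_n := \row_j (if j \in r then 2 else 1).
have hd r : uniq r -> expands (diag_mx (d r)) (2 ^+ size r).
  elim: r => [_|k r IH /= /andP[kr /IH h]].
    by rewrite (_ : diag_mx _ = 1%:M)//= ?expr0; [exact: expands1|apply/matrixP => ? ?; rewrite !mxE].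
  rewrite (_ : diag_mx _ = scale_mx k 2 *m diag_mx (d r)); last first.
    rewrite mulmx_diag; congr diag_mx; apply/rowP => j; rewrite !mxE inE.
    by case: eqP => [->|_]; rewrite /= ?(negbTE kr) ?mulr1 ?mul1r.
  rewrite exprSr; apply: (expandsM (@expands_scale_nat k 1) h) => //.
  rewrite unitmxE det_diag unitfE; apply/prodf_neq0 => j _; rewrite mxE.
  by case: ifP => _; rewrite ?pnatr_eq0 ?oner_eq0.
have n0 : (0 < n)%N := leq_ltn_trans (leq0n i) (ltn_ord i).
have E : scale_mx i 2^-1 = diag_mx (d (enum [pred j | j != i])) *m (2^-1)%:M.
  rewrite -diag_const_mx mulmx_diag; congr diag_mx; apply/rowP => j; rewrite !mxE mem_enum inE.
  by case: eqP => _ /=; rewrite ?mul1r ?mulfV.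
rewrite E; have := hd _ (enum_uniq [pred j | j != i]).
rewrite -cardE cardC1 card_ord => h.
have half0 : 0 < 2^-1 :> R by rewrite invr_gt0.
have u2 : (2^-1)%:M \in @unitmx R n by rewrite unitmxE det_scalar unitfE expf_neq0 ?gt_eqF.
apply: expands_le (expandsM h (expands_scalar half0) u2 _); last by rewrite exprn_ge0// ltW.
by rewrite -[in leRHS](prednK n0) exprS -mulrA -exprMn mulVf// expr1n mulr1.
Qed.

Lemma expands_scale_le i a b t : 0 < a <= b -> expands (scale_mx i a) t ->
  expands (scale_mx i b) t.
Proof.
move=> /andP[a0 ab]; have b0 := lt_le_trans a0 ab; apply: vol_geS => _ [x /ball01P x1 <-].
exists (x *m scale_mx i (a / b)); last by rewrite -mulmxA scale_mxM divfK// gt_eqF.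
apply/ball01P => j; rewrite mul_scale_mx mxE; case: ifP => // _.
rewrite normrM (le_lt_trans _ (x1 j))// ler_piMr// ger0_norm; last by rewrite divr_ge0// ltW.
by rewrite ler_pdivrMr// mul1r.
Qed.

(** Dyadic numbers approximate [|a|] from below and the factor is monotone; a negative [a] is
    reduced to [- a] by a reflection. *)
Lemma expands_scale i a : a != 0 -> expands (scale_mx i a) `|a|.
Proof.
have pow k : expands (scale_mx i (2^-1 ^+ k)) (2^-1 ^+ k).
  elim: k => [|k IH]; first by rewrite expr0 scale_mx1; exact: expands1.
  rewrite exprSr -scale_mxM mulrC; apply: (expandsM IH (@expands_scale_half i)) => //.
  by apply: scale_mx_unit; rewrite invr_eq0 pnatr_eq0.
have pos b : 0 < b -> expands (scale_mx i b) b.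
  move=> b0; apply: vol_ge_closed => t tb; rewrite -/(expands _ _).
  have [t0|t0] := leP t 0; first by apply: vol_ge_le t0 _; exact: vol_ge0.
  (* The dyadic step [e] is smaller than [b - t], so the largest multiple of [e] not exceeding [b]
     is still above [t]. *)
  pose k := Num.bound (b - t)^-1; pose e : R := 2^-1 ^+ k.
  have e0 : 0 < e by rewrite exprn_gt0// invr_gt0.
  have eb : e < b - t.
    rewrite /e exprVn invf_plt ?posrE ?exprn_gt0 ?subr_gt0//.
    by apply: upper_nthrootP.
  pose m := Num.truncn (b / e).
  have bm : m%:R <= b / e < m.+1%:R by apply: truncn_itv; rewrite divr_ge0 ?ltW.
  have m0 : (0 < m)%N.
    rewrite truncn_gt0 ler_pdivlMr// mul1r; lra.
  have me : expands (scale_mx i (m%:R * e)) (m%:R * e).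
    rewrite -scale_mxM mulrC -(prednK m0); apply: (expandsM (@expands_scale_nat i _) (pow k)).
      by apply: scale_mx_unit; rewrite gt_eqF.
    by rewrite ltW.
  move: bm; rewrite ler_pdivlMr// ltr_pdivrMr// -natr1 mulrDl mul1r => /andP[b1 b2].
  apply: (@expands_le _ _ (m%:R * e)); first lra.
  by apply: expands_scale_le me; rewrite b1 mulr_gt0 ?ltr0n.
move=> a0; have [ap|an] := ltP 0 a; first by rewrite gtr0_norm//; exact: pos.
have an' : 0 < - a by rewrite oppr_gt0 lt_neqAle a0.
rewrite ler0_norm// (_ : scale_mx i a = scale_mx i (-1) *m scale_mx i (- a)); last first.
  by rewrite scale_mxM mulN1r opprK.
rewrite -[X in expands _ X]mulr1.
have uN : scale_mx i (-1) \in unitmx by rewrite scale_mx_unit// oppr_eq0 oner_eq0.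
apply: (fun h => @expandsM _ _ 1 (- a) h (pos _ an')); rewrite ?ltW ?scale_mx_unit ?oppr_eq0//.
apply: expands_isometry => // x j; exists j.
have -> : invmx (scale_mx i (-1)) = scale_mx i (-1).
  by rewrite -[RHS](mulKmx uN) scale_mxM mulrNN mulr1 scale_mx1 mulmx1.
by rewrite mul_scale_mx mxE; case: ifP; rewrite ?mulrN1 ?normrN.
Qed.

Definition shear_mx i (l : 'rV[R]_n) : 'M[R]_n := 1%:M + delta_mx i (0 : 'I_1) *m l.

Lemma mul_shear_mx i l x : x *m shear_mx i l = x + x 0 i *: l.
Proof.
rewrite mulmxDr mulmx1 mulmxA -colE; apply/rowP => j.
by rewrite !mxE big_ord_recl big_ord0 addr0 !mxE.
Qed.

Lemma row_mx_ext T U : (forall x, x *m T = x *m U) -> T = U.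
Proof. by move=> h; apply/row_matrixP => i; rewrite !rowE. Qed.

Lemma shear_mxD i l l' : l 0 i = 0 -> shear_mx i l *m shear_mx i l' = shear_mx i (l + l').
Proof.
move=> li; apply: row_mx_ext => x; rewrite mulmxA !mul_shear_mx !mxE li mulr0 addr0.
by rewrite scalerDr addrA.
Qed.

Lemma shear_mx0 i : shear_mx i 0 = 1%:M.
Proof. by rewrite /shear_mx mulmx0 addr0. Qed.

Lemma shear_mx_unit i l : l 0 i = 0 -> shear_mx i l \in unitmx.
Proof.
move=> li; have /mulmx1_unit[] // : shear_mx i l *m shear_mx i (- l) = 1%:M.
by rewrite shear_mxD// subrr shear_mx0.
Qed.

Lemma shear_mx_conj i l a : l 0 i = 0 -> a != 0 ->
  scale_mx i a *m shear_mx i l *m scale_mx i a^-1 = shear_mx i (a *: l).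
Proof.
move=> li a0; apply: row_mx_ext => x; rewrite !mulmxA mul_scale_mx mul_shear_mx mul_scale_mx.
rewrite mul_shear_mx; apply/rowP => j; rewrite !mxE eqxx; case: eqP => [->|_]; last first.
  by rewrite -mulrA.
by rewrite li !mulr0 !addr0 mulfK.
Qed.

(* Conjugating by the dilation of the i-th coordinate turns the shear along [l]
   into the shear along [2 l] without changing the expansion factor, so it can
   be computed from arbitrarily small shears. *)
Lemma expands_shear i l : l 0 i = 0 -> expands (shear_mx i l) 1.
Proof.
move=> li.
have dbl l' t : l' 0 i = 0 -> 0 <= t -> expands (shear_mx i l') t ->
    expands (shear_mx i (2 *: l')) t.
  move=> l'i t0 h; rewrite -shear_mx_conj// -[t](mulKf (_ : 2 != 0 :> R))// [2 * t]mulrC.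
  apply: (expandsM (expandsM (@expands_scale_nat i 1) h (shear_mx_unit l'i) t0)
    (@expands_scale_half i)); first by rewrite scale_mx_unit// invr_eq0.
  by rewrite invr_ge0.
have pow k l' t : l' 0 i = 0 -> 0 <= t -> expands (shear_mx i l') t ->
    expands (shear_mx i (2 ^+ k *: l')) t.
  move=> l'i t0 h; elim: k => [|k IH]; first by rewrite expr0 scale1r.
  by rewrite exprS -scalerA; apply: dbl IH; rewrite // mxE l'i mulr0.
(* The shear along [l / 2 ^+ k] has size below [e]. Its inverse moves a point of the cube of radius
   [1 - e] by at most [(1 - e) e], hence into radius [1 - e ^+ 2 < 1], so the image of the unit cube
   contains that smaller cube. *)
have small e : 0 < e < 1 -> expands (shear_mx i l) ((1 - e) ^+ n).
  move=> /andP[e0 e1]; pose k := Num.bound (e^-1 * (`|l| + 1)).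
  have l1 : 0 < `|l| + 1 by rewrite ltr_wpDl.
  have ek : `|l| < e * 2 ^+ k.
    apply: lt_trans (_ : `|l| + 1 < _); first by rewrite ltrDl.
    by rewrite -ltr_pdivrMl//; apply: upper_nthrootP.
  have k0 : (2 ^+ k : R) != 0 by rewrite expf_neq0.
  rewrite -[l](scalerKV k0); apply: pow; first by rewrite mxE li mulr0.
    by rewrite exprn_ge0// subr_ge0 ltW.
  apply: packed_vol_ge; apply: (@packed_cube _ _ _ 0); first by rewrite subr_gt0.
  move=> y; rewrite -ball_normE /ball_ /= sub0r normrN => ye.
  exists (y *m shear_mx i (- ((2 ^+ k)^-1 *: l))); last first.
    by rewrite -mulmxA shear_mxD ?addNr ?shear_mx0 ?mulmx1// !mxE li mulr0 oppr0.
  rewrite sub0r normrN mul_shear_mx.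
  have ke : `|(2 ^+ k)^-1 *: l| < e.
    by rewrite normrZ normfV ger0_norm ?exprn_ge0// mulrC ltr_pdivrMr// exprn_gt0.
  rewrite (le_lt_trans (ler_normD _ _))// normrZ normrN.
  have yi : `|y 0 i| <= `|y| := rV_coord_le y i.
  have h : `|y 0 i| * `|(2 ^+ k)^-1 *: l| <= (1 - e) * e.
    by rewrite ler_pM// ltW// (le_lt_trans yi).
  apply: lt_trans (ltr_leD ye h) _.
  by rewrite -subr_gt0 (_ : _ - _ = e * e) ?mulr_gt0//; ring.
apply: vol_ge_closed => t t1; have [t0|t0] := leP t 0.
  by apply: vol_ge_le t0 _; exact: vol_ge0.
have n0 : (0 < n)%N := leq_ltn_trans (leq0n i) (ltn_ord i).
have nR : 0 < n%:R :> R by rewrite ltr0n.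
(* By Bernoulli's inequality [(1 - e) ^+ n] is at least [1 - n e = (1 + t) / 2], which exceeds
   [t]. *)
pose e := (1 - t) / (n%:R * 2).
have e0 : 0 < e by rewrite divr_gt0 ?subr_gt0 ?mulr_gt0.
have ne : n%:R * e = (1 - t) / 2 by rewrite /e; field; rewrite gt_eqF.
have e1 : e < 1.
  have : e <= n%:R * e by apply: ler_peMl; [exact: ltW|rewrite ler1n].
  by rewrite ne; lra.
apply: expands_le (small e _); last by rewrite e0.
by apply: le_trans (one_sub_expn n _); rewrite ?ne ?(ltW e0) ?(ltW e1)//; lra.
Qed.

Definition rowop_mx i l : 'M[R]_n := \matrix_(j, k) if j == i then l 0 k else (j == k)%:R.

Lemma mul_rowop_mx i l T : rowop_mx i l *m T =
  \matrix_(j, k) if j == i then (l *m T) 0 k else T j k.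
Proof.
apply/matrixP => j k; rewrite !mxE; case: ifPn => ji.
  by apply: eq_bigr => m _; rewrite !mxE ji.
rewrite (bigD1 j)//= !mxE (negbTE ji) eqxx mul1r big1 ?addr0// => m mj.
by rewrite !mxE (negbTE ji) eq_sym (negbTE mj) mul0r.
Qed.

(** With a nonzero pivot [l 0 i], the row operation is a scaling followed by a shear, so its
    expansion factor is the absolute value of the pivot. *)
Lemma rowop_mxE i l : l 0 i != 0 ->
  rowop_mx i l = scale_mx i (l 0 i) *m shear_mx i ((l 0 i)^-1 *: l - delta_mx 0 i).
Proof.
move=> li; apply: row_mx_ext => x; rewrite mulmxA mul_scale_mx mul_shear_mx.
apply/rowP => j; rewrite !mxE !eqxx (bigD1 i)//= !mxE eqxx.
case: eqP => [->|/eqP ji].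
  rewrite mulVf// subrr mulr0 addr0 big1 ?addr0// => m mi.
  by rewrite !mxE (negbTE mi) mulr0.
rewrite subr0 mulrA mulfK// addrC (bigD1 j)//= !mxE (negbTE ji) eqxx mulr1 big1 ?addr0//.
by move=> m /andP[mi mj]; rewrite !mxE (negbTE mi) (negbTE mj) mulr0.
Qed.

Lemma rowop_mx_unit i l : l 0 i != 0 -> rowop_mx i l \in unitmx.
Proof.
move=> li; rewrite rowop_mxE// unitmx_mul scale_mx_unit// shear_mx_unit//.
by rewrite !mxE !eqxx mulVf// subrr.
Qed.

Lemma expands_rowop i l : l 0 i != 0 -> expands (rowop_mx i l) `|l 0 i|.
Proof.
move=> li; have l'i : ((l 0 i)^-1 *: l - delta_mx 0 i) 0 i = 0.
  by rewrite !mxE !eqxx mulVf// subrr.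
rewrite rowop_mxE// -[`|_|]mul1r; apply: expandsM => //.
- exact: expands_scale.
- exact: expands_shear.
- exact: shear_mx_unit.
Qed.

(** The order of the list [s] encodes the triangular shape: the increasing enumeration gives lower
    triangular matrices, the decreasing one upper triangular matrices. *)
Lemma expands_triangular (s : seq 'I_n) T : uniq s -> (forall i, i \in s) ->
  pairwise (fun i j => T i j == 0) s -> (forall i, T i i != 0) ->
  T \in unitmx /\ expands T (\prod_i `|T i i|).
Proof.
move=> us sP ps di.
pose part (s' : seq 'I_n) : 'M[R]_n := \matrix_(i, j) if i \in s' then T i j else (i == j)%:R.
suff h s' : uniq s' -> pairwise (fun i j => T i j == 0) s' ->
    part s' \in unitmx /\ expands (part s') (\prod_(i <- s') `|T i i|).
  have [] := h s us ps; rewrite (_ : part s = T) => [Tu hT|]; last first.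
    by apply/matrixP => i j; rewrite mxE sP.
  split=> //; move: hT; rewrite (perm_big (index_enum 'I_n))//.
  apply: uniq_perm => //; first exact: index_enum_uniq.
  by move=> i; rewrite sP mem_index_enum.
elim: s' => [_ _|i s' IH /= /andP[iss us'] /andP[/allP iz /(IH us')[pu hp]]].
  have -> : part [::] = 1%:M by apply/matrixP => i j; rewrite !mxE.
  by rewrite unitmx1 big_nil; split=> //; exact: expands1.
have E : part (i :: s') = rowop_mx i (row i T) *m part s'.
  rewrite mul_rowop_mx; apply/matrixP => j k; rewrite !mxE inE.
  case: eqP => [->|_] //=; rewrite (bigID (mem s'))/= big1 => [|m ms]; last first.
    by rewrite mxE (eqP (iz m ms)) mul0r.
  rewrite add0r; have [ks|ks] := boolP (k \in s').
    rewrite (eqP (iz k ks)) big1// => m ms; rewrite !mxE (negbTE ms).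
    by case: eqP ms ks => [->/negbTE ->//|_ _ _]; rewrite mulr0.
  rewrite (bigD1 k)//= !mxE (negbTE ks) eqxx mulr1 big1 ?addr0// => m /andP[ms mk].
  by rewrite !mxE (negbTE ms) (negbTE mk) mulr0.
have ri : row i T 0 i != 0 by rewrite mxE.
rewrite E unitmx_mul pu rowop_mx_unit//; split=> //.
rewrite big_cons mulrC; apply: expandsM => //; last by rewrite prodr_ge0.
by have := expands_rowop ri; rewrite mxE.
Qed.

Lemma expands_perm (s : 'S_n) : expands (perm_mx s) 1.
Proof.
apply: expands_isometry; first exact: unitmx_perm.
have sV : perm_mx s *m perm_mx s^-1 = 1%:M :> 'M[R]_n by rewrite -perm_mxM mulgV perm_mx1.
move=> x i; exists (s i); rewrite -[invmx _]mulmx1 -sV mulKmx ?unitmx_perm//.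
by rewrite -col_permE mxE.
Qed.

Lemma abs_det_perm (s : 'S_n) : `|\det (perm_mx s) : R| = 1.
Proof. by rewrite det_perm normrX normrN1 expr1n. Qed.

End Expansion.

(** The permutation and the unit lower triangular factor contribute 1, and the diagonal of [U]
    contributes the absolute value of the determinant. Size 0 is treated apart because [cormen_lup]
    takes matrices of positive size. *)
Lemma expands_det {R : realType} {n : nat} (T : 'M[R]_n) : T \in unitmx ->
  expands T `|\det T|.
Proof.
case: n T => [T _|n T Tu].
  rewrite det_mx00 normr1 (flatmx0 T) -(flatmx0 1%:M); exact: expands1.
have := cormen_lup_correct T; have := cormen_lup_perm T; have := cormen_lup_detL T.
have := @cormen_lup_lower _ _ T; have := @cormen_lup_upper _ _ T.
case: (cormen_lup T) => [[P L] U] /= Uup Llo detL /is_perm_mxP[s Ps] PT.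
have {PT} PT : perm_mx s *m T = L *m U by rewrite -Ps.
have srt : sorted (fun i j : 'I_n.+1 => (i < j)%N) (enum 'I_n.+1).
  by rewrite -(@sorted_map _ _ (@nat_of_ord _) ltn) val_enum_ord iota_ltn_sorted.
have ltT : transitive (fun i j : 'I_n.+1 => (i < j)%N) by move=> i j k; exact: ltn_trans.
have gtT : transitive (fun i j : 'I_n.+1 => (j < i)%N).
  by move=> i j k /[swap]; exact: ltn_trans.
have detU : \det U = \prod_i U i i.
  rewrite -det_tr det_trig; first by apply: eq_bigr => i _; rewrite mxE.
  by apply/is_trig_mxP => i j ij; rewrite mxE Uup.
have detPT : \det (perm_mx s) * \det T = \det U.
  by rewrite -det_mulmx PT det_mulmx detL mul1r.
have absU : `|\det T| = `|\det U| by rewrite -detPT normrM abs_det_perm mul1r.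
have U0 i : U i i != 0.
  have : \det U != 0 by rewrite -normr_eq0 -absU normr_eq0 -unitfE -unitmxE.
  by rewrite detU => /prodf_neq0/(_ i isT).
have [Lu Le] : L \in unitmx /\ expands L (\prod_i `|L i i|).
  apply: (@expands_triangular _ _ (enum 'I_n.+1)).
  - exact: enum_uniq.
  - by move=> i; rewrite mem_enum.
  - apply: sub_pairwise (_ : pairwise (fun i j : 'I_n.+1 => (i < j)%N) _).
      by move=> i j ij; rewrite Llo ?(ltnW ij)// -val_eqE/= ltn_eqF.
    by rewrite -sorted_pairwise.
  - by move=> i; rewrite Llo// eqxx oner_eq0.
have [Uu Ue] : U \in unitmx /\ expands U (\prod_i `|U i i|).
  apply: (@expands_triangular _ _ (rev (enum 'I_n.+1))).
  - by rewrite rev_uniq enum_uniq.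
  - by move=> i; rewrite mem_rev mem_enum.
  - apply: sub_pairwise (_ : pairwise (fun i j : 'I_n.+1 => (j < i)%N) _).
      by move=> i j ij; rewrite Uup.
    by rewrite -sorted_pairwise// rev_sorted.
  - by [].
have sV : perm_mx s^-1 *m perm_mx s = 1%:M :> 'M[R]_n.+1.
  by rewrite -perm_mxM mulVg perm_mx1.
have -> : T = perm_mx s^-1 *m (L *m U) by rewrite -PT mulmxA sV mul1mx.
have P0 : 0 <= \prod_i `|U i i| by rewrite prodr_ge0.
have LU := expandsM Le Ue Uu P0.
have := expandsM (expands_perm s^-1) LU.
rewrite [X in _ * X]big1 ?mulr1 => [|i _]; last by rewrite Llo// eqxx normr1.
rewrite -PT mulmxA sV mul1mx absU detU normr_prod; apply=> //.
by rewrite PT unitmx_mul Lu.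
Qed.

(** * An upper bound on packings by counting lattice points *)

Section Boundedness.
Context {R : realType} {n : nat}.
Implicit Types (S : set 'rV[R]_n) (m k : nat).

Definition lattice_point m (p : {ffun 'I_n -> 'I_m.*2}) : 'rV[R]_n :=
  \row_i ((p i : nat)%:R / m%:R - 1).

Definition lattice_count m S :=
  #|[set p : {ffun 'I_n -> 'I_m.*2} | `[< S (lattice_point p) >]]%SET|.

Lemma lattice_count_cat m S S1 S2 : S1 `<=` S -> S2 `<=` S -> S1 `&` S2 = set0 ->
  (lattice_count m S1 + lattice_count m S2 <= lattice_count m S)%N.
Proof.
move=> s1 s2 s12; rewrite /lattice_count -cardsUI.
rewrite [X in (_ + #|pred_of_set X|)%N](_ : _ = finset.set0) ?cards0 ?addn0.
  apply: subset_leq_card; apply/fintype.subsetP => p; rewrite !inE.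
  by case/orP => /asboolP h; [exact/s1|exact/s2].
apply/setP => p; rewrite !inE; apply/negbTE/negP => /andP[/asboolP h1 /asboolP h2].
by have : (S1 `&` S2) (lattice_point p) by []; rewrite s12.
Qed.

Lemma lattice_countS m S S' : S `<=` S' -> (lattice_count m S <= lattice_count m S')%N.
Proof.
move=> SS'; apply: subset_leq_card; apply/fintype.subsetP => p; rewrite !inE.
exact: SS'.
Qed.

(** Once [r m > 1], a side of length [2 r] carries more than [r m] lattice points of spacing
    [1 / m]. Half of the expected [2 r m] is given away to absorb rounding, since only finiteness is
    at stake. *)
Lemma lattice_count_cube (c : 'rV[R]_n) (r : R) : 0 < r -> ball c r `<=` ball 0 1 ->
  exists m0, forall m, (m0 <= m)%N ->
    (r * m%:R) ^+ n <= (lattice_count m (ball c r))%:R.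
Proof.
move=> r0 sub; exists (Num.bound r^-1).+1 => m mm.
have m0 : (0 < m)%N by exact: leq_trans mm.
have mR : 0 < m%:R :> R by rewrite ltr0n.
have rm : 1 < r * m%:R.
  rewrite mulrC -ltr_pdivrMr// div1r (lt_le_trans (archi_boundP _))//.
    by rewrite invr_ge0 ltW.
  by rewrite ler_nat ltnW.
have c1 i : - 1 < c 0 i < 1.
  have /cubeP/(_ i) := sub c (ballxx c r0).
  by rewrite -ltr_norml mxE sub0r normrN; apply.
(* If the left face lay below [-1], the cube would contain a point with [i]-th coordinate [-1],
   which is outside the open unit cube. *)
have cr i : 0 <= c 0 i + 1 - r.
  rewrite subr_ge0 leNgt; apply/negP => h.
  have : ball (0 : 'rV[R]_n) 1 (\row_j if j == i then -1 else c 0 j).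
    apply: sub; apply/cubeP => // j; rewrite mxE.
    case: eqP => [->|_]; last by rewrite subrr normr0.
    by rewrite opprK ger0_norm// -lerBlDr sub0r ltW//; have /andP[] := c1 i.
  by move/cubeP => /(_ ltr01 i); rewrite !mxE eqxx sub0r opprK normr1 ltxx.
pose a i := m%:R * (c 0 i + 1 - r).
have a0 i : 0 <= a i by rewrite mulr_ge0// ltW.
(* Index of the first lattice point strictly to the right of the left face [c_i - r]; the [K]
   indices starting there stay inside the cube. *)
pose o i := (Num.truncn (a i)).+1.
have oa i : a i < (o i)%:R <= a i + 1.
  by rewrite -natr1 lerD2r natr1; have /andP[-> ->] := truncn_itv (a0 i).
pose K := (Num.truncn (r * m%:R)).+1.
have rm0 : 0 <= r * m%:R by rewrite mulr_ge0// ltW.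
have /andP[K1 K2] := truncn_itv rm0; rewrite -/K in K2.
have inb i (q : 'I_K) : `|c 0 i - ((o i + q)%:R / m%:R - 1)| < r.
  have /andP[ao1 ao2] := oa i.
  have q1 : (q : nat)%:R <= r * m%:R :> R by apply: le_trans K1; rewrite ler_nat -ltnS.
  have q0 : 0 <= (q : nat)%:R :> R by [].
  have E : (c 0 i - ((o i + q)%:R / m%:R - 1)) * m%:R = a i + r * m%:R - (o i)%:R - (q : nat)%:R.
    by rewrite natrD /a; field; rewrite gt_eqF.
  rewrite -(ltr_pM2r mR) -{2}(gtr0_norm mR) -normrM E ltr_norml.
  by move: ao1 ao2 q1 q0 rm; lra.
have ltm i (q : 'I_K) : (o i + q < m.*2)%N.
    have bin : ball c r (\row_j if j == i then (o i + q)%:R / m%:R - 1 else c 0 j).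
    apply/cubeP => // j; rewrite mxE; case: eqP => [->|_]; first exact: inb.
    by rewrite subrr normr0.
  have /(cubeP _ _ ltr01)/(_ i) := sub _ bin; rewrite !mxE eqxx sub0r normrN ltr_norml => /andP[_].
  by rewrite ltrBlDr ltr_pdivrMr// -(ltr_nat R) -muln2 natrM mulrC.
pose phi (q : {ffun 'I_n -> 'I_K}) : {ffun 'I_n -> 'I_m.*2} := [ffun i => Ordinal (ltm i (q i))].
have phiI : injective phi.
  move=> q q' /ffunP h; apply/ffunP => i; have := h i; rewrite !ffunE => -[] /eqP.
  by rewrite eqn_add2l => /eqP/val_inj.
apply: (@le_trans _ _ (K ^ n)%:R).
  by rewrite natrX lerXn2r ?nnegrE// ltW.
rewrite ler_nat -[X in (X ^ n)%N]card_ord -[X in (_ ^ X)%N]card_ord -card_ffun.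
rewrite -(card_imset _ phiI) subset_leq_card//; apply/fintype.subsetP => p /imsetP[q _ ->].
rewrite inE; apply/asboolP/cubeP => // i; rewrite mxE ffunE; exact: inb.
Qed.

Lemma packed_count S t : packed S t -> S `<=` ball 0 1 ->
  exists m0, forall m, (m0 <= m)%N -> t * m%:R ^+ n <= (lattice_count m S)%:R.
Proof.
elim=> {S t} [S _|S c r r0 cS S1|S S1 S2 t1 t2 s1 s2 s12 p1 h1 p2 h2 SS].
- by exists 0%N => m _; rewrite mul0r.
- have [m0 h] := lattice_count_cube r0 (subset_trans cS S1).
  exists m0 => m /h; rewrite exprMn => /le_trans; apply.
  by rewrite ler_nat lattice_countS.
have [m1 k1] := h1 (subset_trans s1 SS); have [m2 k2] := h2 (subset_trans s2 SS).
exists (maxn m1 m2) => m; rewrite geq_max => /andP[/k1 i1 /k2 i2].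
rewrite mulrDl (le_trans (lerD i1 i2))// -natrD ler_nat.
exact: lattice_count_cat.
Qed.

(** All lattice points together number [(2 m) ^ n]. This bound is what makes the supremum in
    [unit_ball_vol] meaningful. *)
Lemma packed_bounded S t : packed S t -> S `<=` ball 0 1 -> t <= 2 ^+ n.
Proof.
move=> p /(packed_count p)[m0 /(_ m0.+1 (leqnSn _))] h.
have m1 : 0 < m0.+1%:R ^+ n :> R by rewrite exprn_gt0.
rewrite -(ler_pM2r m1) (le_trans h)// -exprMn -natrM mul2n -natrX ler_nat.
by rewrite (leq_trans (max_card _))// card_ffun !card_ord.
Qed.

End Boundedness.

(** * Subdivision of a cube into a grid of cells *)

Section Grid.
Context {R : realType} {n : nat}.
Implicit Types (c y : 'rV[R]_n) (r : R) (m : nat).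

(** The offsets [2 s + 1 - m] run from [1 - m] to [m - 1] in steps of 2, so the open cells of
    half-side [r / m] are disjoint and fill the cube up to their faces. *)
Definition grid_center c r m (s : {ffun 'I_n -> 'I_m}) : 'rV[R]_n :=
  \row_i (c 0 i + r / m%:R * ((s i).*2.+1%:R - m%:R)).

Lemma grid_le c r m (s : {ffun 'I_n -> 'I_m}) y : (0 < m)%N -> 0 < r ->
  `|grid_center c r s - y| <= r / m%:R -> `|c - y| <= r.
Proof.
move=> m0 r0; have mR : 0 < m%:R :> R by rewrite ltr0n.
have rm : 0 < r / m%:R by rewrite divr_gt0.
rewrite !rV_norm_le ?(ltW r0) ?(ltW rm)// => h i; have := h i; rewrite !mxE !ler_norml.
have s0 : 0 <= (s i : nat)%:R :> R by [].
have s1 : (s i : nat)%:R + 1 <= m%:R :> R by rewrite natr1 ler_nat.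
have := mulr_ge0 (ltW rm) s0; have : 0 <= r / m%:R * (m%:R - ((s i : nat)%:R + 1)).
  by rewrite mulr_ge0 ?(ltW rm)// subr_ge0.
have E : r / m%:R * m%:R = r by rewrite divfK// gt_eqF.
rewrite -natr1 -muln2 natrM !mulrBr !mulrDr E; lra.
Qed.

Lemma grid_sub c r m (s : {ffun 'I_n -> 'I_m}) : (0 < m)%N -> 0 < r ->
  ball (grid_center c r s) (r / m%:R) `<=` ball c r.
Proof.
move=> m0 r0 y; have mR : 0 < m%:R :> R by rewrite ltr0n.
have rm : 0 < r / m%:R by rewrite divr_gt0.
rewrite !cubeP// => h i; have := h i; rewrite !mxE !ltr_norml.
have s0 : 0 <= (s i : nat)%:R :> R by [].
have s1 : (s i : nat)%:R + 1 <= m%:R :> R by rewrite natr1 ler_nat.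
have := mulr_ge0 (ltW rm) s0; have : 0 <= r / m%:R * (m%:R - ((s i : nat)%:R + 1)).
  by rewrite mulr_ge0 ?(ltW rm)// subr_ge0.
have E : r / m%:R * m%:R = r by rewrite divfK// gt_eqF.
rewrite -natr1 -muln2 natrM !mulrBr !mulrDr E; lra.
Qed.

Lemma grid_disjoint c r m (s t : {ffun 'I_n -> 'I_m}) : (0 < m)%N -> 0 < r -> s != t ->
  ball (grid_center c r s) (r / m%:R) `&` ball (grid_center c r t) (r / m%:R) = set0.
Proof.
move=> m0 r0 st; have mR : 0 < m%:R :> R by rewrite ltr0n.
have rm : 0 < r / m%:R by rewrite divr_gt0.
have [i sti] : exists i, s i != t i.
  by apply/existsP; apply: contraR st => /existsPn h; apply/eqP/ffunP => i; apply/eqP/negPn/h.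
rewrite -subset0 => y [/(cubeP _ _ rm).1/(_ i) h1 /(cubeP _ _ rm).1/(_ i) h2] /=.
wlog : s t st sti h1 h2 / (s i < t i)%N.
  move=> W; have [/W|/W|/val_inj/eqP] := ltngtP (s i) (t i).
  - exact.
  - by apply=> //; rewrite eq_sym.
  - by rewrite (negbTE sti).
rewrite -(ler_nat R) -natr1 => lt.
have : 0 <= r / m%:R * ((t i : nat)%:R - ((s i : nat)%:R + 1)).
  by rewrite mulr_ge0 ?(ltW rm)// subr_ge0.
move: h1 h2; rewrite !mxE !ltr_norml -[in X in X -> _ -> _ -> _]natr1 -!muln2.
rewrite -![(_ * 2).+1%:R]natr1 !natrM !mulrBr !mulrDr; lra.
Qed.

End Grid.

(** * From local to global volume estimates *)

Section Globalization.
Context {R : realType} {n : nat}.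
Implicit Types (c x y : 'rV[R]_n) (r e : R).

Definition cball c r : set 'rV[R]_n := [set y | `|c - y| <= r].

Lemma cball_closed_ball c r : 0 < r -> cball c r = closed_ball c r.
Proof. by move=> r0; rewrite closed_ballE. Qed.

Lemma cball_compact c r : 0 < r -> compact (cball c r).
Proof.
move=> r0; apply: bounded_closed_compact.
  exists (`|c| + r); split; first by rewrite num_real.
  move=> M cM y /= cy; rewrite (le_trans _ (ltW cM))//.
  by rewrite -[y](subKr c) (le_trans (ler_normB _ _))// lerD2l.
by rewrite cball_closed_ball//; exact: closed_ball_closed.
Qed.

Lemma ball_cball c r : ball c r `<=` cball c r.
Proof. by move=> y; rewrite -ball_normE => /ltW. Qed.

(** The infinitesimal form of the volume estimate. Centre and radius vary independently, so it
    applies to cells that are merely near [x], as the compactness argument requires. *)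
Definition good_cubes (f : 'rV[R]_n -> 'rV[R]_n) (A K : set 'rV[R]_n) x :=
  forall e, 0 < e -> \forall c \near x & r \near 0^'+, cball c r `<=` K ->
    vol_ge (f @` (ball c r `&` A)) ((1 - e) * r ^+ n).

(** Compactness turns the pointwise thresholds of [good_cubes] into a single [d]. The cube is cut
    into cells smaller than [d]; injectivity makes their images disjoint, and the contents add
    up. *)
Lemma vol_ge_cover f (A : set 'rV[R]_n) c0 r0 : 0 < r0 ->
  (forall y z, cball c0 r0 y -> cball c0 r0 z -> A y -> A z -> f y = f z -> y = z) ->
  (forall x, cball c0 r0 x -> good_cubes f A (cball c0 r0) x) ->
  vol_ge (f @` (ball c0 r0 `&` A)) (r0 ^+ n).
Proof.
move=> r00 inj good; apply: vol_ge_closed => t tr.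
have r0n : 0 < r0 ^+ n by rewrite exprn_gt0.
(* Chosen so that [(1 - e) * r0 ^+ n] is exactly [t]. *)
pose e := (r0 ^+ n - t) / r0 ^+ n.
have e0 : 0 < e by rewrite divr_gt0// subr_gt0.
have := (compact_near_coveringP _).1 (cball_compact r00) _ _
  (fun r c => cball c r `<=` cball c0 r0 ->
    vol_ge (f @` (ball c r `&` A)) ((1 - e) * r ^+ n)) _ (fun x Kx => good x Kx e e0).
move=> /(_ _)[d /= d0 hd].
pose m := (Num.bound (r0 / d)).+1; have mR : 0 < m%:R :> R by [].
have rm : 0 < r0 / m%:R by rewrite divr_gt0.
have rmd : r0 / m%:R < d.
  rewrite ltr_pdivrMr// mulrC -ltr_pdivrMr// (lt_le_trans (archi_boundP _))//.
    by rewrite divr_ge0// ltW.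
  by rewrite ler_nat.
have -> : t = \sum_(s : {ffun 'I_n -> 'I_m}) (1 - e) * (r0 / m%:R) ^+ n.
  rewrite sumr_const card_ffun !card_ord -[X in _ = X]mulr_natr natrX -mulrA -exprMn divfK ?gt_eqF//.
  by rewrite mulrBl mul1r divfK ?gt_eqF//; lra.
apply: (@vol_ge_sum _ _ _ _ (fun s => f @` (ball (grid_center c0 r0 s) (r0 / m%:R) `&` A))).
- move=> s u _ _ su; rewrite -subset0 => _ [[y [ys Ay] <-] [z [zu Az]]] zy.
  have yz : y = z.
    by apply: inj => //; apply: ball_cball; [exact: grid_sub ys|exact: grid_sub zu].
  have : (ball (grid_center c0 r0 s) (r0 / m%:R) `&` ball (grid_center c0 r0 u) (r0 / m%:R)) y.
    by split; [exact: ys|rewrite yz].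
  by rewrite grid_disjoint.
- by move=> s _; apply: image_subset => y [ys Ay]; split=> //; exact: grid_sub ys.
move=> s _; apply: (hd (r0 / m%:R)) => //=.
- by rewrite sub0r normrN gtr0_norm.
- by apply: (@grid_le _ _ _ _ _ s); rewrite ?subrr ?normr0 ?ltW.
- by move=> y; apply: grid_le.
Qed.

End Globalization.

(** * Strict differentiability *)

Section StrictDerivative.
Context {R : realType} {n : nat}.
Implicit Types (h : 'rV[R]_n -> R) (x y z u : 'rV[R]_n) (l : 'cV[R]_n).

Definition pairing u l : R := (u *m l) 0 0.

Lemma pairingE u l : pairing u l = \sum_i u 0 i * l i 0.
Proof. by rewrite /pairing mxE. Qed.

Lemma pairingD u l l' : pairing u (l + l') = pairing u l + pairing u l'.
Proof. by rewrite /pairing mulmxDr mxE. Qed.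

Lemma pairingZ u a l : pairing u (a *: l) = a * pairing u l.
Proof. by rewrite /pairing -scalemxAr mxE. Qed.

Lemma pairing0 u : pairing u 0 = 0.
Proof. by rewrite /pairing mulmx0 mxE. Qed.

Definition l1norm l : R := \sum_i `|l i 0|.

Lemma l1norm_ge0 l : 0 <= l1norm l.
Proof. exact: sumr_ge0. Qed.

Lemma pairing_le u l : `|pairing u l| <= l1norm l * `|u|.
Proof.
rewrite pairingE (le_trans (ler_norm_sum _ _ _))// mulr_suml ler_sum// => i _.
by rewrite normrM mulrC ler_wpM2l// rV_coord_le.
Qed.

(** Both points vary near [x], so [h] minus its linear part has a small Lipschitz constant there.
    Ordinary differentiability at [x] would not give this, and the contraction argument for local
    inversion rests on it. *)
Definition strict_deriv h x l := forall e, 0 < e -> exists2 d, 0 < d &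
  forall y z, ball x d y -> ball x d z ->
    `|h y - h z - pairing (y - z) l| <= e * `|y - z|.

Lemma ballW x d d' y : d <= d' -> ball x d y -> ball x d' y.
Proof. by move=> dd'; apply: le_ball. Qed.

Lemma strict_deriv_near h k x l : (\forall y \near x, h y = k y) ->
  strict_deriv h x l -> strict_deriv k x l.
Proof.
move=> /nbhs_ballP[d1 /= d10 hk] sh e /sh[d d0 H].
exists (Num.min d d1); first by rewrite lt_min d0.
move=> y z xy xz; rewrite -!hk; first apply: H.
- by apply: ballW xy; rewrite ge_min lexx.
- by apply: ballW xz; rewrite ge_min lexx.
- by apply: ballW xz; rewrite ge_min lexx orbT.
- by apply: ballW xy; rewrite ge_min lexx orbT.
Qed.

Lemma strict_deriv_lip h x l : strict_deriv h x l -> exists2 d, 0 < d &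
  forall y z, ball x d y -> ball x d z -> `|h y - h z| <= (l1norm l + 1) * `|y - z|.
Proof.
move=> /(_ 1 ltr01)[d d0 H]; exists d => // y z xy xz.
have := H _ _ xy xz; have := pairing_le (y - z) l.
rewrite mul1r mulrDl mul1r => h1 h2.
rewrite -[h y - h z](subrK (pairing (y - z) l)) addrC (le_trans (ler_normD _ _))//.
exact: lerD.
Qed.

Lemma strict_deriv_near_eq h x l e : strict_deriv h x l -> 0 < e -> exists2 d, 0 < d &
  forall y, ball x d y -> `|h y - h x| <= e.
Proof.
move=> /strict_deriv_lip[d d0 H] e0; have l0 := l1norm_ge0 l.
have l1 : 0 < l1norm l + 1 by rewrite ltr_wpDl.
exists (Num.min d (e / (l1norm l + 1))); first by rewrite lt_min d0 divr_gt0.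
move=> y; rewrite -ball_normE /ball_ /= lt_min => /andP[y1 y2].
have := H y x; rewrite -ball_normE /ball_ /= subrr normr0 => /(_ y1 d0)/le_trans; apply.
by rewrite distrC mulrC -ler_pdivlMr// ltW.
Qed.

Lemma strict_deriv_cst a x : strict_deriv (fun=> a) x 0.
Proof. by move=> e e0; exists 1 => // y z _ _; rewrite pairing0 !subrr normr0 mulr_ge0// ltW. Qed.

Lemma strict_derivD h k x l l' : strict_deriv h x l -> strict_deriv k x l' ->
  strict_deriv (fun y => h y + k y) x (l + l').
Proof.
move=> sh sk e e0; have e2 : 0 < e / 2 by rewrite divr_gt0.
have [d1 d10 H1] := sh _ e2; have [d2 d20 H2] := sk _ e2.
exists (Num.min d1 d2); first by rewrite lt_min d10.
move=> y z xy xz; rewrite pairingD.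
have := H1 y z (ballW _ xy) (ballW _ xz); have := H2 y z (ballW _ xy) (ballW _ xz).
rewrite !ge_min !lexx ?orbT => /(_ isT isT) h2 /(_ isT isT) h1.
rewrite (_ : _ - _ = (h y - h z - pairing (y - z) l) + (k y - k z - pairing (y - z) l')); last by ring.
rewrite (le_trans (ler_normD _ _))// (le_trans (lerD h1 h2))// -mulrDl.
by rewrite [e in leRHS]splitr.
Qed.

Lemma strict_derivM h k x l l' : strict_deriv h x l -> strict_deriv k x l' ->
  strict_deriv (fun y => h y * k y) x (h x *: l' + k x *: l).
Proof.
move=> sh sk e e0.
(* Sum of the coefficients of the four error terms below, where [h y] and [k z] are bounded by their
   values at [x] plus 1; this is why [e'] is kept at most 1. *)
pose M := `|h x| + `|k x| + 2 + l1norm l + l1norm l'.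
have M0 : 0 < M.
  have := l1norm_ge0 l; have := l1norm_ge0 l'; have := normr_ge0 (h x).
  by have := normr_ge0 (k x); rewrite /M; lra.
pose e' := Num.min 1 (e / M).
have e'0 : 0 < e' by rewrite lt_min ltr01 divr_gt0.
have e'1 : e' <= 1 by rewrite ge_min lexx.
have e'M : M * e' <= e by rewrite mulrC -ler_pdivlMr// ge_min lexx orbT.
have [d1 d10 H1] := sh _ e'0; have [d2 d20 H2] := sk _ e'0.
have [d3 d30 H3] := strict_deriv_near_eq sh e'0.
have [d4 d40 H4] := strict_deriv_near_eq sk e'0.
exists (Num.min (Num.min d1 d2) (Num.min d3 d4)); first by rewrite !lt_min d10 d20 d30.
move=> y z xy xz; have /and4P[m1 m2 m3 m4] : [&& Num.min (Num.min d1 d2) (Num.min d3 d4) <= d1,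
   Num.min (Num.min d1 d2) (Num.min d3 d4) <= d2, Num.min (Num.min d1 d2) (Num.min d3 d4) <= d3 &
   Num.min (Num.min d1 d2) (Num.min d3 d4) <= d4] by rewrite !ge_min !lexx !orbT.
have h1 := H1 y z (ballW m1 xy) (ballW m1 xz).
have h2 := H2 y z (ballW m2 xy) (ballW m2 xz).
have h3 := H3 y (ballW m3 xy); have h4 := H4 z (ballW m4 xz).
have hy : `|h y| <= `|h x| + 1.
  by rewrite -[h y](subrK (h x)) (le_trans (ler_normD _ _))// addrC lerD2l (le_trans h3).
have kz : `|k z| <= `|k x| + 1.
  by rewrite -[k z](subrK (k x)) (le_trans (ler_normD _ _))// addrC lerD2l (le_trans h4).
have p1 := pairing_le (y - z) l; have p2 := pairing_le (y - z) l'.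
rewrite pairingD !pairingZ.
set p := pairing _ l in h1 p1 *; set p' := pairing _ l' in h2 p2 *; set w := `|y - z| in h1 h2 p1 p2 *.
have w0 : 0 <= w := normr_ge0 _.
rewrite (_ : _ - _ = h y * (k y - k z - p') + (h y - h x) * p' +
  (k z * (h y - h z - p) + (k z - k x) * p)); last by ring.
apply: le_trans (_ : M * e' * w <= _); last by rewrite ler_wpM2r.
have b1 : `|h y * (k y - k z - p')| <= (`|h x| + 1) * (e' * w) by rewrite normrM ler_pM.
have b2 : `|(h y - h x) * p'| <= e' * (l1norm l' * w) by rewrite normrM ler_pM.
have b3 : `|k z * (h y - h z - p)| <= (`|k x| + 1) * (e' * w) by rewrite normrM ler_pM.
have b4 : `|(k z - k x) * p| <= e' * (l1norm l * w) by rewrite normrM ler_pM.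
apply: le_trans (ler_normD _ _) _; apply: le_trans (lerD (ler_normD _ _) (ler_normD _ _)) _.
apply: le_trans (lerD (lerD b1 b2) (lerD b3 b4)) _.
by rewrite /M le_eqVlt; apply/orP; left; apply/eqP; ring.
Qed.

Lemma strict_deriv_comp h (psi : R -> R) c x l : strict_deriv h x l ->
  (forall e, 0 < e -> exists2 d, 0 < d & forall s t, `|s - h x| <= d -> `|t - h x| <= d ->
     `|psi s - psi t - c * (s - t)| <= e * `|s - t|) ->
  strict_deriv (psi \o h) x (c *: l).
Proof.
move=> sh sp e e0; have l0 := l1norm_ge0 l.
pose M := (l1norm l + 1) + `|c|; have M0 : 0 < M by rewrite ltr_pwDl// ltr_wpDl.
have e'0 : 0 < e / M by rewrite divr_gt0.
have [d d0 H] := sp _ e'0; have [d1 d10 H1] := sh _ e'0.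
have [d2 d20 H2] := strict_deriv_near_eq sh d0; have [d3 d30 H3] := strict_deriv_lip sh.
exists (Num.min d1 (Num.min d2 d3)); first by rewrite !lt_min d10 d20.
move=> y z xy xz; have /and3P[m1 m2 m3] : [&& Num.min d1 (Num.min d2 d3) <= d1,
  Num.min d1 (Num.min d2 d3) <= d2 & Num.min d1 (Num.min d2 d3) <= d3].
  by rewrite !ge_min !lexx !orbT.
have h1 := H1 y z (ballW m1 xy) (ballW m1 xz).
have h3 := H3 y z (ballW m3 xy) (ballW m3 xz).
have h2 := H _ _ (H2 y (ballW m2 xy)) (H2 z (ballW m2 xz)).
rewrite /= pairingZ.
rewrite (_ : _ - _ = (psi (h y) - psi (h z) - c * (h y - h z)) +
  c * (h y - h z - pairing (y - z) l)); last by ring.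
rewrite (le_trans (ler_normD _ _))// normrM.
have b1 : `|c| * `|h y - h z - pairing (y - z) l| <= `|c| * (e / M * `|y - z|) by rewrite ler_wpM2l.
have b2 : e / M * `|h y - h z| <= e / M * ((l1norm l + 1) * `|y - z|).
  by rewrite ler_wpM2l// ltW.
apply: le_trans (lerD (le_trans h2 b2) b1) _.
have -> : e * `|y - z| = e / M * M * `|y - z| by rewrite divfK ?gt_eqF.
rewrite le_eqVlt; apply/orP; left; apply/eqP.
by move: (e / M) => q; rewrite /M; ring.
Qed.

Lemma strict_deriv_rsqrt h x l : strict_deriv h x l -> 0 < h x ->
  strict_deriv (fun y => (Num.sqrt (h y))^-1) x
    (- (2^-1 * (Num.sqrt (h x))^-1 ^+ 3) *: l).
Proof.
move=> sh hx; apply: (strict_deriv_comp (psi := fun t => (Num.sqrt t)^-1)) sh _ => e e0.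
set a := h x in hx *.
have sa : 0 < Num.sqrt a by rewrite sqrtr_gt0.
(* The exact difference quotient: [1 / sqrt s - 1 / sqrt t = - k (s, t) * (s - t)], with [k]
   continuous at [(a, a)] and equal there to half of [(sqrt a)^-1 ^+ 3]. *)
pose k (p : R * R) := (Num.sqrt p.1 * Num.sqrt p.2 * (Num.sqrt p.1 + Num.sqrt p.2))^-1.
have ck : {for (a, a), continuous k}.
  have c1 : Num.sqrt p.1 @[p --> (a, a)] --> Num.sqrt a.
    by apply: (@cvg_comp _ _ _ fst Num.sqrt _ (nbhs a)); [exact: cvg_fst|exact: sqrt_continuous].
  have c2 : Num.sqrt p.2 @[p --> (a, a)] --> Num.sqrt a.
    by apply: (@cvg_comp _ _ _ snd Num.sqrt _ (nbhs a)); [exact: cvg_snd|exact: sqrt_continuous].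
  apply: cvgV; first by rewrite /= mulf_neq0 ?mulf_neq0 ?gt_eqF// addr_gt0.
  by apply: cvgM; [exact: cvgM|exact: cvgD].
have /cvgrPdist_le/(_ e e0)/nbhs_ballP[d /= d0 H] := ck.
exists (Num.min (d / 2) (a / 2)); first by rewrite lt_min !divr_gt0.
move=> s t; rewrite !le_min => /andP[s1 s2] /andP[t1 t2].
have s0 : 0 < s by move: s2; rewrite ler_norml => /andP[s2 _]; lra.
have t0 : 0 < t by move: t2; rewrite ler_norml => /andP[t2 _]; lra.
have kst := H (s, t); have {kst} : `|k (a, a) - k (s, t)| <= e.
  apply: kst; split => /=; rewrite -ball_normE /ball_ /= distrC.
    by rewrite (le_lt_trans s1)// ltr_pdivrMr// ltr_pMr// ltr1n.
  by rewrite (le_lt_trans t1)// ltr_pdivrMr// ltr_pMr// ltr1n.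
have rs : 0 < Num.sqrt s by rewrite sqrtr_gt0.
have rt : 0 < Num.sqrt t by rewrite sqrtr_gt0.
have -> : (Num.sqrt s)^-1 - (Num.sqrt t)^-1 - - (2^-1 * (Num.sqrt a)^-1 ^+ 3) * (s - t) =
  (k (a, a) - k (s, t)) * (s - t).
  have -> : s - t = Num.sqrt s ^+ 2 - Num.sqrt t ^+ 2 by rewrite !sqr_sqrtr// ltW.
  rewrite /k /=; field.
  by rewrite !gt_eqF// addr_gt0.
by move=> ke; rewrite normrM ler_wpM2r.
Qed.

End StrictDerivative.

(** * From smoothness to strict differentiability *)

Section SmoothStrict.
Context {R : realType}.

(** The mean value theorem on the segment from [z] to [y] expresses [g y - g z] by the partial
    derivatives at an intermediate point. These are close to those at [x] because [smooth_on] makes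
    them differentiable, hence continuous, at [x]. Four coordinates share the error, whence
    [e / 4]. *)
Lemma smooth_strict_deriv (V : set 'rV[R]_4) (g : 'rV[R]_4 -> R) x : open V -> V x ->
  smooth_on V g -> strict_deriv g x (\col_i 'D_(delta_mx 0 i) g x).
Proof.
move=> oV Vx sg e e0.
have dg y : V y -> differentiable g y by exact: (sg [::]).
have Dlin y u : V y -> 'D_u g y = \sum_i u 0 i * 'D_(delta_mx 0 i) g y.
  move=> Vy; rewrite deriveE; last exact: dg.
  rewrite {1}(row_sum_delta u) linear_sum; apply: eq_bigr => i _.
  by rewrite linearZ /= deriveE//; exact: dg.
pose e' := e / 4%:R; have e'0 : 0 < e' by rewrite divr_gt0.
have [d d0 H] : exists2 d, 0 < d & forall y, ball x d y -> V y /\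
    forall i, `|'D_(delta_mx 0 i) g x - 'D_(delta_mx 0 i) g y| <= e'.
  have : \forall y \near x, V y /\ forall i, `|'D_(delta_mx 0 i) g x - 'D_(delta_mx 0 i) g y| <= e'.
    apply: filterI; first exact: open_nbhs_nbhs.
    apply: (@filter_forall _ 'I_4 (fun i y => `|'D_(delta_mx 0 i) g x - 'D_(delta_mx 0 i) g y| <= e') (nbhs x)) => i.
    have /differentiable_continuous := sg [:: delta_mx 0 i] x Vx.
    by move=> /cvgrPdist_le/(_ e' e'0).
  by move=> /nbhs_ballP[d /= d0 H]; exists d.
exists d => // y z xy xz.
pose phi (t : R) := g (z + t *: (y - z)).
have seg (t : R) : t \in `[0, 1] -> ball x d (z + t *: (y - z)).
  rewrite in_itv /= => /andP[t0 t1]; move: xy xz; rewrite -ball_normE /ball_ /= => xy xz.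
  rewrite (_ : x - _ = t *: (x - y) + (1 - t) *: (x - z)); last first.
    by rewrite !scalerBr !scalerBl !scale1r; apply/rowP => i; rewrite !mxE; ring.
  rewrite (le_lt_trans (ler_normD _ _))// !normrZ ger0_norm// ger0_norm ?subr_ge0//.
  have [->|tn] := eqVneq t 0; first by rewrite mul0r add0r subr0 mul1r.
  have tp : 0 < t by rewrite lt_def tn.
  have b1 : t * `|x - y| < t * d by rewrite ltr_pM2l.
  have b2 : (1 - t) * `|x - z| <= (1 - t) * d by rewrite ler_wpM2l ?subr_ge0// ltW.
  by apply: lt_le_trans (ltr_leD b1 b2) _; rewrite -mulrDl addrC subrK mul1r.
have dphi (t : R) : t \in `[0, 1] -> is_derive t (1 : R) phi ('D_(y - z) g (z + t *: (y - z))).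
  move=> /seg/H[Vt _]; have dgt := dg _ Vt.
  have E : (fun s : R => s^-1 *: (phi (s *: 1 + t) - phi t)) =
           (fun s : R => s^-1 *: (g (s *: (y - z) + (z + t *: (y - z))) - g (z + t *: (y - z)))).
    apply/funext => s; rewrite /phi; congr (_ *: (g _ - _)).
    by rewrite scalerDl addrCA -[s *: 1]/(s * 1) mulr1.
  have dd : derivable g (z + t *: (y - z)) (y - z) by exact: diff_derivable.
  split; first by rewrite /derivable /= E.
  by rewrite /derive /= E.
have cphi : {within `[0 : R, 1], continuous phi}.
  apply: derivable_within_continuous => t t01.
  by have [] := dphi t t01.
have [t t01] := MVT_segment (@ler01 R) (fun (t : R) (h : t \in `]0, 1[) => dphi t (subset_itv_oo_cc h)) cphi.
move=> Et; have {Et} -> : g y - g z = 'D_(y - z) g (z + t *: (y - z)).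
  rewrite -[RHS]mulr1 -[X in _ = _ * X](subr0 1) -Et /phi scale1r scale0r addr0.
  by rewrite [z + (y - z)]addrC subrK.
have [Vt Ht] := H _ (seg t t01); rewrite Dlin// pairingE -sumrB.
rewrite (le_trans (ler_norm_sum _ _ _))//.
apply: le_trans (_ : \sum_(i < 4) e' * `|y - z| <= _); last first.
  by rewrite sumr_const card_ord -mulrnAl /e' -mulr_natr divfK.
apply: ler_sum => i _; rewrite [X in _ - _ * X]mxE -mulrBr normrM mulrC distrC.
by apply: ler_pM => //; exact: rV_coord_le.
Qed.

End SmoothStrict.

(** * Local inversion and the images of small cubes *)

Section LocalExpansion.
Context {R : realType} {n : nat}.
Implicit Types (g : 'rV[R]_n -> 'rV[R]_n) (x y z u : 'rV[R]_n) (T : 'M[R]_n).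

Definition strict_deriv_mx g x T := forall j, strict_deriv (fun y => g y 0 j) x (col j T).

Lemma strict_deriv_mxP g x T e : strict_deriv_mx g x T -> 0 < e -> exists2 d, 0 < d &
  forall y z, ball x d y -> ball x d z -> `|g y - g z - (y - z) *m T| <= e * `|y - z|.
Proof.
move=> sg e0.
have [d d0 H] : exists2 d, 0 < d & forall j y z, ball x d y -> ball x d z ->
    `|g y 0 j - g z 0 j - pairing (y - z) (col j T)| <= e * `|y - z|.
  have /all_sig2[d d0 H] : forall j, {d | 0 < d & forall y z, ball x d y -> ball x d z ->
      `|g y 0 j - g z 0 j - pairing (y - z) (col j T)| <= e * `|y - z|}.
    by move=> j; apply: cid2; exact: (sg j e e0).
  exists (\big[Num.min/1]_j d j); first by apply/bigmin_gtP; split.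
  by move=> j y z xy xz; apply: H; [apply: ballW xy|apply: ballW xz]; exact: bigmin_le_cond.
exists d => // y z xy xz; apply/rV_norm_le; first by rewrite mulr_ge0// ltW.
move=> j; have := H j y z xy xz.
by rewrite /pairing colE mulmxA -colE !mxE.
Qed.

Lemma mulmx_norm_bound T : exists2 C, 0 < C & forall u, `|u *m T| <= C * `|u|.
Proof.
exists (\sum_j l1norm (col j T) + 1).
  by rewrite ltr_wpDl// sumr_ge0// => j _; exact: l1norm_ge0.
move=> u; have s0 : 0 <= \sum_j l1norm (col j T) by rewrite sumr_ge0// => j _; exact: l1norm_ge0.
apply/rV_norm_le => [|j]; first by rewrite mulr_ge0// addr_ge0.
have -> : (u *m T) 0 j = pairing u (col j T) by rewrite /pairing colE mulmxA -colE !mxE.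
rewrite (le_trans (pairing_le _ _))// ler_wpM2r//.
rewrite (bigD1 j)//= -addrA lerDl addr_ge0// sumr_ge0// => k _; exact: l1norm_ge0.
Qed.

(* Edelstein's argument: a minimiser of [|psi y - y|] is a fixed point. *)
Lemma contraction_fixed_point (psi : 'rV[R]_n -> 'rV[R]_n) c r k : 0 < r -> 0 <= k < 1 ->
  (forall y, cball c r y -> cball c r (psi y)) ->
  (forall y z, cball c r y -> cball c r z -> `|psi y - psi z| <= k * `|y - z|) ->
  exists2 y, cball c r y & psi y = y.
Proof.
move=> r0 /andP[k0 k1] stab lip.
have cc : cball c r c by rewrite /cball /= subrr normr0 ltW.
have cont : {within cball c r, continuous (fun y => `|psi y - y|)}.
  apply/subspace_continuousP => y cy; apply/cvgrPdist_le => e e0.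
  rewrite near_withinE; apply/nbhs_ballP; exists (e / 2) => /=; first by rewrite divr_gt0.
  move=> z; rewrite -ball_normE => /ltW /= yz' cz.
  have h : `|psi y - psi z| + `|y - z| <= e.
    apply: le_trans (lerD (lip _ _ cy cz) (lexx _)) _.
    move: (`|y - z|) yz' (normr_ge0 (y - z)) => w yw w0.
    by have := ler_wpM2r w0 (ltW k1); rewrite mul1r; lra.
  apply: le_trans h; apply: le_trans (ler_dist_dist _ _) _.
  rewrite (_ : _ - _ = (psi y - psi z) - (y - z)); last first.
    by apply/rowP => i; rewrite !mxE; ring.
  exact: ler_normB.
have [y yA ymin] := EVT_min_rV (ex_intro _ c cc) (cball_compact r0) cont.
rewrite inE in yA; exists y => //; apply/eqP; rewrite -subr_eq0 -normr_eq0.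
apply/eqP/le_anti; rewrite normr_ge0 andbT leNgt; apply/negP => p0.
have py := stab _ yA.
have := ymin (psi y); rewrite inE => /(_ py); apply/negP; rewrite -ltNge.
by rewrite (le_lt_trans (lip _ _ py yA))// gtr_pMl.
Qed.

(** A quantitative inverse function theorem: [g y = q] is solved by the Newton map [psi] with frozen
    derivative [T], which strict differentiability makes a contraction of ratio [e / 2]. *)
Lemma strict_inverse g x T e : T \in unitmx -> strict_deriv_mx g x T -> 0 < e < 1 ->
  exists2 d, 0 < d & forall c r, 0 < r -> ball c r `<=` ball x d ->
    [set g c + u *m T | u in ball 0 ((1 - e) * r)] `<=` g @` ball c r.
Proof.
move=> Tu sg /andP[e0 e1]; have [C C0 HC] := mulmx_norm_bound (invmx T).
have eC : 0 < e / 2 / C by rewrite !divr_gt0.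
have [d d0 Hd] := strict_deriv_mxP sg eC; exists d => // c r r0 cx _ [u + <-].
rewrite -ball_normE /ball_ /= sub0r normrN => ur.
pose q := g c + u *m T; pose psi y := y - (g y - q) *m invmx T.
(* The first step [psi c - c = u] is shorter than [(1 - e) r] and the contraction adds at most
   [(e / 2) r]; the sum is this radius, so the closed cube is stable. *)
pose r' := (1 - e / 2) * r.
have r'0 : 0 < r' by rewrite mulr_gt0// subr_gt0; lra.
have r'r : r' < r by rewrite gtr_pMl//; lra.
have sub y : cball c r' y -> ball c r y.
  by move=> /le_lt_trans/(_ r'r); rewrite -ball_normE.
have cc : cball c r' c by rewrite /cball /= subrr normr0 ltW.
have lip y z : cball c r' y -> cball c r' z -> `|psi y - psi z| <= e / 2 * `|y - z|.
  move=> /sub/cx xy /sub/cx xz.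
  have -> : psi y - psi z = - ((g y - g z - (y - z) *m T) *m invmx T).
    rewrite mulmxBl mulmxK// opprB /psi; apply/rowP => i; rewrite !mulmxBl !mxE; ring.
  rewrite normrN (le_trans (HC _))// (le_trans (ler_wpM2l (ltW C0) (Hd _ _ xy xz)))//.
  by rewrite mulrA [C * _]mulrC divfK ?gt_eqF.
have [| |y cy yfix] := contraction_fixed_point r'0 _ _ lip; first lra.
  have pc : psi c = c + u by rewrite /psi /q opprD addrA subrr sub0r mulNmx mulmxK// opprK.
  move=> y cy; rewrite /cball /= (_ : c - psi y = (psi c - psi y) - u); last first.
    by rewrite pc; apply/rowP => i; rewrite !mxE; ring.
  rewrite (le_trans (ler_normB _ _))// (le_trans (lerD (lip _ _ cc cy) (ltW ur)))//.
  have : e / 2 * `|c - y| <= e / 2 * r by rewrite ler_wpM2l ?divr_ge0 ?(ltW e0)// (le_trans cy) ?(ltW r'r).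
  by rewrite /r' !mulrBl !mul1r; lra.
exists y; first by have := sub y cy; rewrite -ball_normE.
have : (g y - q) *m invmx T = 0.
  by move: yfix; rewrite /psi => /eqP; rewrite subr_eq addrC -subr_eq subrr eq_sym => /eqP.
move=> /(congr1 (mulmx^~ T)); rewrite mulmxKV// mul0mx => /eqP; rewrite subr_eq0.
by move=> /eqP.
Qed.

Lemma strict_deriv_vol g x T e : T \in unitmx -> strict_deriv_mx g x T -> 0 < e < 1 ->
  exists2 d, 0 < d & forall c r, 0 < r -> ball c r `<=` ball x d ->
    vol_ge (g @` ball c r) (`|\det T| * ((1 - e) * r) ^+ n).
Proof.
move=> Tu sg e01; have [d d0 H] := strict_inverse Tu sg e01.
exists d => // c r r0 cx; apply: (vol_geS (H c r r0 cx)).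
have e1 : 0 < 1 - e by move: e01; lra.
have := @expands_cube R n T _ 0 _ (mulr_gt0 e1 r0) (expands_det Tu).
move=> /(vol_ge_affine (g c) ltr01); rewrite expr1n mul1r.
apply: vol_geS => _ [_ [u u1 <-] <-]; exists u => //.
by rewrite scale1r.
Qed.

Lemma cball_sub_ball x d c r : ball x (d / 2) c -> r < d / 2 -> cball c r `<=` ball x d.
Proof.
move=> + rd y cy; rewrite -!ball_normE /ball_ /= => xc.
rewrite (le_lt_trans (ler_distD c _ _))//.
by rewrite (lt_le_trans (ltr_leD xc cy))//; lra.
Qed.

Lemma good_cubesI (f : 'rV[R]_n -> 'rV[R]_n) (A K : set 'rV[R]_n) x :
  (forall e, 0 < e < 1 -> exists2 d, 0 < d & forall c r, 0 < r -> cball c r `<=` ball x d ->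
    cball c r `<=` K -> vol_ge (f @` (ball c r `&` A)) ((1 - e) * r ^+ n)) ->
  good_cubes f A K x.
Proof.
move=> H e e0; pose e' := Num.min e 2^-1.
have e'1 : 0 < e' < 1 by rewrite lt_min e0 invr_gt0 ltr0n/= gt_min invf_lt1 ?ltr1n ?orbT.
have [d d0 Hd] := H _ e'1; have d2 : 0 < d / 2 by rewrite divr_gt0.
exists (ball x (d / 2), [set r | 0 < r < d / 2]).
  split=> /=; first exact: nbhsx_ballx.
  exists (d / 2) => //= r /=; rewrite sub0r normrN => rd r0; rewrite r0 /=.
  by rewrite (le_lt_trans (ler_norm _)).
move=> [c r] [/= xc /andP[r0 rd]] cK.
apply: vol_ge_le (Hd c r r0 (cball_sub_ball xc rd) cK).
by rewrite ler_wpM2r ?exprn_ge0 ?(ltW r0)// lerD2l lerN2 ge_min lexx.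
Qed.

Lemma good_cubes_strict (f : 'rV[R]_n -> 'rV[R]_n) (A K : set 'rV[R]_n) x T :
  `|\det T| = 1 -> strict_deriv_mx f x T -> (\forall y \near x, A y) -> good_cubes f A K x.
Proof.
move=> detT sf /nbhs_ballP[d1 /= d10 HA]; apply: good_cubesI => e /andP[e0 e1].
have Tu : T \in unitmx by rewrite unitmxE unitfE -normr_eq0 detT oner_eq0.
have nR : 0 < n.+1%:R :> R by [].
(* Bernoulli's inequality costs a factor [n]; dividing by [n + 1] keeps the total loss below [e] and
   makes sense for [n = 0]. *)
have e'1 : 0 < e / n.+1%:R < 1.
  by rewrite divr_gt0//= ltr_pdivrMr// mul1r (lt_le_trans e1)// ler1n.
have [d d0 Hd] := strict_deriv_vol Tu sf e'1.
exists (Num.min d d1); first by rewrite lt_min d0.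
move=> c r r0 cx _.
have -> : ball c r `&` A = ball c r.
  apply/seteqP; split=> [y []//|y cy]; split=> //; apply: HA.
  have := cx y (ball_cball cy); rewrite -ball_normE /ball_ /= lt_min => /andP[_].
  by [].
apply: vol_ge_le (Hd c r r0 _); last first.
  move=> y cy; have := cx y (ball_cball cy); rewrite -ball_normE /ball_ /= lt_min => /andP[+ _].
  by [].
rewrite detT mul1r exprMn ler_wpM2r ?exprn_ge0 ?(ltW r0)//.
apply: (@le_trans _ _ (1 - n%:R * (e / n.+1%:R))); last first.
  by apply: one_sub_expn; move: e'1 => /andP[/ltW-> /ltW->].
rewrite lerD2l lerN2 mulrA ler_pdivrMr// mulrC ler_wpM2l ?(ltW e0)// ler_nat//.
Qed.

(** * Grid cells meeting a regular zero set *)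

Section ZeroSet.
Variables (h : 'rV[R]_n -> R) (x : 'rV[R]_n) (l : 'cV[R]_n) (i : 'I_n).
Hypotheses (sh : strict_deriv h x l) (li : l i 0 != 0).

(* In a column of the grid parallel to the i-th axis, the zero set of [h] meets
   only boundedly many cells; recording the i-th index modulo [C] and forgetting
   it otherwise is therefore injective on the cells that meet the zero set. *)
Lemma grid_zero_count : exists C : nat, exists2 d, 0 < d &
  forall m c r, (0 < m)%N -> 0 < r -> cball c r `<=` ball x d ->
  (#|[set s : {ffun 'I_n -> 'I_m} | `[< exists2 y, cball (grid_center c r s) (r / m%:R) y & h y = 0%R >]]%SET|
    * m <= m ^ n * C)%N.
Proof.
pose a := `|l i 0|; have a0 : 0 < a by rewrite normr_gt0.
have a20 : 0 < a / 2 by rewrite divr_gt0.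
have l0 := l1norm_ge0 l.
(* For zeros in two cells of one column at index distance [D], strict differentiability with error
   [a / 2] gives [2 rho |D| a <= (a / 2) (2 rho |D| + 2 rho) + 2 rho (l1norm l)], that is
   [|D| <= b]. *)
pose b := 2 * l1norm l / a + 1.
have b0 : 0 <= b by rewrite addr_ge0// divr_ge0// ?mulr_ge0// ltW.
pose C := (Num.bound b).+1; exists C.
have [d d0 Hd] := sh a20; exists d => // m c r m0 r0 cx.
have mR : 0 < m%:R :> R by rewrite ltr0n.
pose rho := r / m%:R; have rho0 : 0 < rho by rewrite divr_gt0.
set B := finset _.
have key (s t : {ffun 'I_n -> 'I_m}) : s \in B -> t \in B -> (forall j, j != i -> s j = t j) ->
    `|(s i : nat)%:R - (t i : nat)%:R| <= b :> R.
  rewrite !inE => -[y ys hy] -[z zt hz] st.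
  have := Hd y z (cx _ (grid_le m0 r0 ys)) (cx _ (grid_le m0 r0 zt)).
  rewrite hy hz subr0 sub0r normrN.
  pose D : R := (s i : nat)%:R - (t i : nat)%:R.
  pose w := y - z - (2 * rho * D) *: delta_mx 0 i.
  have gst : grid_center c r s - grid_center c r t = (2 * rho * D) *: delta_mx 0 i.
    apply/rowP => j; rewrite !mxE /D; case: (eqVneq j i) => [->|/st->]; last by rewrite mulr0 subrr.
    by rewrite eqxx mulr1 -!natr1 -!muln2 !natrM /rho; ring.
  have w2 : `|w| <= 2 * rho.
    rewrite /w -gst (_ : _ - _ = (grid_center c r t - z) - (grid_center c r s - y)).
      rewrite (le_trans (ler_normB _ _))// (le_trans (lerD zt ys))//.
      by rewrite -/rho mulr_natl mulr2n.
    by apply/rowP => j; rewrite !mxE; ring.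
  have -> : y - z = (2 * rho * D) *: delta_mx 0 i + w by rewrite /w [RHS]addrC subrK.
  have -> : pairing ((2 * rho * D) *: delta_mx 0 i + w) l = 2 * rho * D * l i 0 + pairing w l.
    rewrite /pairing mulmxDl mxE -scalemxAl mxE -rowE mxE; ring.
  move=> h1.
  have n1 : `|(2 * rho * D) *: delta_mx 0 i + w| <= 2 * rho * `|D| + 2 * rho.
    rewrite (le_trans (ler_normD _ _))// lerD// normrZ 2!normrM (gtr0_norm rho0) normr_nat.
    have k0 : 0 <= 2 * rho * `|D|.
      exact: mulr_ge0 (mulr_ge0 (ler0n _ 2) (ltW rho0)) (normr_ge0 _).
    rewrite -[leRHS]mulr1; apply: (ler_wpM2l k0).
    apply/rV_norm_le => // j; rewrite mxE.
    by case: (_ && _); rewrite ?normr1 ?normr0.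
  have p1 : `|pairing w l| <= l1norm l * (2 * rho).
    by rewrite (le_trans (pairing_le _ _))// ler_wpM2l.
  have h2 : 2 * rho * `|D| * a <= a / 2 * (2 * rho * `|D| + 2 * rho) + l1norm l * (2 * rho).
    have -> : 2 * rho * `|D| * a = `|2 * rho * D * l i 0|.
      by rewrite 3!normrM (gtr0_norm rho0) normr_nat.
    rewrite -[2 * rho * D * l i 0](addrK (pairing w l)) (le_trans (ler_normB _ _))//.
    by rewrite lerD// (le_trans h1)// ler_wpM2l// ltW.
  have h3 : rho * a * `|D| <= rho * a * b.
    have -> : rho * a * b = rho * (2 * l1norm l + a) by rewrite /b; field; rewrite gt_eqF.
    by move: h2; lra.
  by move: h3; rewrite ler_pM2l// mulr_gt0.
(* The freed [i]-th slot stores a second index from ['I_m], which is where the factor [m] on the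
   left of the bound comes from. *)
pose F (p : {ffun 'I_n -> 'I_m} * 'I_m) : {ffun 'I_n -> 'I_m} * 'I_C :=
  ([ffun j => if j == i then p.2 else p.1 j], inord (p.1 i %% C)).
have FI : {in [set p : {ffun 'I_n -> 'I_m} * 'I_m | p.1 \in B]%SET &, injective F}.
  move=> [s k] [t k']; rewrite !inE /= => sB tB [/ffunP E1 E2].
  have kk : k = k' by have := E1 i; rewrite !ffunE eqxx.
  have st j : j != i -> s j = t j by move=> ji; have := E1 j; rewrite !ffunE (negbTE ji).
  congr (_, _) => //; apply/ffunP => j; have [->|/st//] := eqVneq j i.
  have {}E2 : (s i = t i %[mod C])%N.
    by have := congr1 val E2; rewrite /= !inordK// ltn_mod.
  apply/val_inj/eqP => /=; rewrite eqn_leq.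
  wlog suff W : s t k k' sB tB E1 kk st E2 / (s i <= t i)%N.
    apply/andP; split; first exact: W sB tB E1 kk st E2.
    by apply: (W t s k' k) => // j' /st.
  rewrite leqNgt; apply/negP => lt.
  have bC : (s i - t i < C)%N.
    rewrite -(ltr_nat R) natrB ?(ltnW lt)//.
    have sB' : s \in B by rewrite !inE.
    have tB' : t \in B by rewrite !inE.
    have := key s t sB' tB' st; rewrite ger0_norm ?subr_ge0 ?ler_nat ?(ltnW lt)//.
    by move=> /le_lt_trans; apply; rewrite (lt_le_trans (archi_boundP b0))// ler_nat.
  have : (C %| s i - t i)%N by rewrite -eqn_mod_dvd ?(ltnW lt)//; apply/eqP.
  by move=> /dvdn_leq; rewrite subn_gt0 lt leqNgt bC => /(_ isT).
have <- : #|[set p : {ffun 'I_n -> 'I_m} * 'I_m | p.1 \in B]%SET| = (#|B| * m)%N.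
  have -> : (#|B| * m = #|finset.setX B [set: 'I_m]%SET|)%N by rewrite cardsX cardsT card_ord.
  apply: eq_card => -[s k].
  by rewrite !inE /= andbT.
rewrite -(card_in_imset FI) (leq_trans (max_card _))//.
by rewrite card_prod card_ffun !card_ord.
Qed.

(** Closed cells that miss the zero set lie in [A] and keep their full content. The others are at
    most a fraction [C / m] of the grid, and [m] is taken large enough to make this at most [e]. *)
Lemma good_cubes_zero_set (f : 'rV[R]_n -> 'rV[R]_n) (A K : set 'rV[R]_n) :
  (forall y z, K y -> K z -> A y -> A z -> f y = f z -> y = z) ->
  (\forall y \near x, ~ A y -> h y = 0) ->
  (forall c r, 0 < r -> cball c r `<=` K -> cball c r `<=` A ->
     vol_ge (f @` (ball c r `&` A)) (r ^+ n)) ->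
  good_cubes f A K x.
Proof.
move=> inj /nbhs_ballP[d1 /= d10 Ah] H; apply: good_cubesI => e /andP[e0 e1].
have [C [d d0 Hd]] := grid_zero_count.
pose m := (Num.bound (C%:R / e)).+1; have m0 : (0 < m)%N by [].
have mR : 0 < m%:R :> R by rewrite ltr0n.
have Cm : C%:R <= e * m%:R.
  rewrite mulrC -ler_pdivrMr// ltW// (lt_le_trans (archi_boundP _)) ?ler_nat//.
  by rewrite divr_ge0// ltW.
exists (Num.min d d1); first by rewrite lt_min d0.
move=> c r r0 cx cK; have rm : 0 < r / m%:R by rewrite divr_gt0.
have cd : cball c r `<=` ball x d by move=> y /cx; apply: ballW; rewrite ge_min lexx.
have cd1 : cball c r `<=` ball x d1 by move=> y /cx; apply: ballW; rewrite ge_min lexx orbT.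
have {Hd} := Hd m c r m0 r0 cd; set B := finset _ => Bm.
apply: (@vol_ge_le _ _ _ _ (\sum_(s | s \notin B) (r / m%:R) ^+ n)).
  rewrite sumr_const; set N := #|_|.
  have NB : (N * m + m ^ n * C >= m ^ n * m)%N.
    rewrite -[X in (X ^ n * m)%N]card_ord -[X in (_ ^ X * m)%N]card_ord -card_ffun -(cardC (mem B)) addnC.
    by rewrite mulnDl leq_add2l.
  have NR : m%:R ^+ n * m%:R <= N%:R * m%:R + m%:R ^+ n * C%:R :> R.
    by rewrite -!natrX -!natrM -natrD ler_nat.
  have mn : 0 < m%:R ^+ n :> R by rewrite exprn_gt0.
  have NR2 : (1 - e) * m%:R ^+ n <= N%:R.
    have hC := ler_wpM2l (ltW mn) Cm; rewrite -(ler_pM2r mR).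
    have -> : (1 - e) * m%:R ^+ n * m%:R = m%:R ^+ n * m%:R - m%:R ^+ n * (e * m%:R) by ring.
    by move: NR hC; lra.
  rewrite -[leRHS]mulr_natl expr_div_n mulrA [leRHS]mulrAC ler_wpM2r//.
    by rewrite exprn_ge0// ltW.
  by rewrite ler_pdivlMr.
apply: (@vol_ge_sum _ _ _ _ (fun s => f @` (ball (grid_center c r s) (r / m%:R) `&` A))).
- move=> s u _ _ su; rewrite -subset0 => _ [[y [ys Ay] <-] [z [zu Az]]] zy.
  have yz : y = z.
    by apply: inj => //; apply: cK; apply: ball_cball; [exact: grid_sub ys|exact: grid_sub zu].
  have : (ball (grid_center c r s) (r / m%:R) `&` ball (grid_center c r u) (r / m%:R)) y.
    by split; [exact: ys|rewrite yz].
  by rewrite grid_disjoint.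
- by move=> s _; apply: image_subset => y [ys Ay]; split=> //; exact: grid_sub ys.
move=> s sB; apply: H => // y ys; first exact/cK/grid_le/ys.
apply: contrapT => nA; move/negP: sB; apply; rewrite !inE; exists y => //.
by apply: Ah nA; apply/cd1/grid_le/ys.
Qed.

End ZeroSet.

End LocalExpansion.

(** * Darboux coordinates on the complement of a line in the projective plane *)

Section Darboux.
Context {R : realType}.
Implicit Types (z u v : 'rV[R[i]]_3) (m j : 'I_3).

Definition zre z j : R := complex.Re (z 0 j).
Definition zim z j : R := complex.Im (z 0 j).

Definition znorm2 z : R := \sum_j (zre z j * zre z j + zim z j * zim z j).

(* The real and imaginary parts of [z_j * conj z_m]. *)
Definition prodre m z j : R := zre z j * zre z m + zim z j * zim z m.
Definition prodim m z j : R := zim z j * zre z m - zre z j * zim z m.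

(** Since [prodre m z m] is [|z_m|^2], this is [1 / (sqrt pi |z| |z_m|)]. *)
Definition zscale m z : R := (Num.sqrt (pi * (znorm2 z * prodre m z m)))^-1.

(* [z] is sent to the coordinates [z_j * (conj z_m / |z_m|) / (sqrt pi * |z|)],
   j <> m, homogeneous of degree 0 in [z]. *)
Definition darboux m z : 'rV[R]_4 := \row_(k < 4)
  let j := lift m (inord k./2 : 'I_2) in
  zscale m z * (if odd k then prodim m z j else prodre m z j).

Definition darboux_chart m (P : @CP2 R) : 'rV[R]_4 := darboux m (vpick (val P)).

Lemma complex_ReM (a b : R[i]) :
  complex.Re (a * b) = complex.Re a * complex.Re b - complex.Im a * complex.Im b.
Proof. by case: a b => [? ?] [? ?]. Qed.

Lemma complex_ImM (a b : R[i]) :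
  complex.Im (a * b) = complex.Re a * complex.Im b + complex.Im a * complex.Re b.
Proof. by case: a b => [? ?] [? ?]. Qed.

Lemma complex_neq0 (a : R[i]) :
  (a != 0) = (0 < complex.Re a * complex.Re a + complex.Im a * complex.Im a).
Proof.
rewrite lt_def -!expr2 addr_ge0 ?sqr_ge0// andbT paddr_eq0 ?sqr_ge0// !sqrf_eq0.
by case: a => a b; rewrite eq_complex.
Qed.

Lemma prodre_gt0 m z : z 0 m != 0 -> 0 < prodre m z m.
Proof. by rewrite complex_neq0. Qed.

Lemma znorm2_ge z m : prodre m z m <= znorm2 z.
Proof.
rewrite /znorm2 (bigD1 m)//= lerDl sumr_ge0// => j _.
by rewrite addr_ge0// -expr2 sqr_ge0.
Qed.

Lemma sum_ord4 (F : 'I_4 -> R) : \sum_k F k =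
  \sum_(j < 2) (F (inord j.*2) + F (inord j.*2.+1)).
Proof.
rewrite !big_ord_recl !big_ord0 /= !addr0 !addrA; congr (F _ + F _ + F _ + F _).
all: by apply/val_inj; rewrite /= ?inordK.
Qed.

Lemma darboux_even m z (j : 'I_2) :
  darboux m z 0 (inord j.*2) = zscale m z * prodre m z (lift m j).
Proof.
rewrite mxE inordK; last by case: j => [[|[|]]].
by rewrite odd_double doubleK inord_val.
Qed.

Lemma darboux_odd m z (j : 'I_2) :
  darboux m z 0 (inord j.*2.+1) = zscale m z * prodim m z (lift m j).
Proof.
rewrite mxE inordK; last by case: j => [[|[|]]].
by rewrite /= odd_double /= uphalf_double inord_val.
Qed.

Lemma zscale_gt0 m z : z 0 m != 0 -> 0 < zscale m z.
Proof.
move=> /prodre_gt0 M0; rewrite invr_gt0 sqrtr_gt0 !mulr_gt0 ?pi_gt0//.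
exact: lt_le_trans (znorm2_ge z m).
Qed.

Lemma zscale_sqr m z : z 0 m != 0 ->
  zscale m z ^+ 2 = (pi * (znorm2 z * prodre m z m))^-1.
Proof.
move=> /prodre_gt0 M0; rewrite exprVn sqr_sqrtr// !mulr_ge0 ?pi_ge0 ?(ltW M0)//.
by rewrite (le_trans (ltW M0))// znorm2_ge.
Qed.

(** Places the image in the ball of capacity 1, with [z_m = 0] as the limiting case of the bounding
    sphere, and recovers [|z_m| / |z|] from the image. *)
Lemma darboux_norm m z : z 0 m != 0 ->
  pi * \sum_k darboux m z 0 k ^+ 2 = 1 - prodre m z m / znorm2 z.
Proof.
move=> zm; have M0 := prodre_gt0 zm; have N0 := lt_le_trans M0 (znorm2_ge z m).
rewrite sum_ord4 (eq_bigr (fun j : 'I_2 => zscale m z ^+ 2 * (prodre m z m *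
  (zre z (lift m j) * zre z (lift m j) + zim z (lift m j) * zim z (lift m j))))); last first.
  by move=> j _; rewrite darboux_even darboux_odd /prodre /prodim; ring.
rewrite -!mulr_sumr zscale_sqr//.
have -> : \sum_(j < 2) (zre z (lift m j) * zre z (lift m j) + zim z (lift m j) * zim z (lift m j)) =
    znorm2 z - prodre m z m.
  by rewrite /znorm2 (bigD1_ord m)//= /prodre addrC addrK.
by move: (pi : R) (pi_gt0 R) => P P0; field; rewrite !gt_eqF.
Qed.

(** Makes [darboux_chart] independent of the representative [vpick], hence computable from the
    coordinates of any affine chart. *)
Lemma darboux_scale m z (a : R[i]) : a != 0 -> darboux m (a *: z) = darboux m z.
Proof.
rewrite complex_neq0; set c := _ + _ => c0.
have pr j : prodre m (a *: z) j = c * prodre m z j.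
  by rewrite /prodre /zre /zim !mxE !complex_ReM !complex_ImM /c; ring.
have pim j : prodim m (a *: z) j = c * prodim m z j.
  by rewrite /prodim /zre /zim !mxE !complex_ReM !complex_ImM /c; ring.
have nn : znorm2 (a *: z) = c * znorm2 z.
  rewrite /znorm2 mulr_sumr; apply: eq_bigr => j _.
  by rewrite /zre /zim !mxE !complex_ReM !complex_ImM /c; ring.
have sc : zscale m (a *: z) = c^-1 * zscale m z.
  rewrite /zscale pr nn (_ : pi * _ = c ^+ 2 * (pi * (znorm2 z * prodre m z m))); last by ring.
  by rewrite sqrtrM ?sqr_ge0// sqrtr_sqr gtr0_norm// invfM.
apply/rowP => k; rewrite !mxE /= sc pr pim.
by case: ifP => _; field; rewrite gt_eqF.
Qed.

(** The norm determines [|z_m| / |z|], hence also the missing coordinate [j = m]. All products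
    [z_j conj z_m] then agree up to one real factor, so [z] and [z'] are proportional. *)
Lemma darboux_inj m z z' : z 0 m != 0 -> z' 0 m != 0 -> darboux m z = darboux m z' ->
  exists2 a, a != 0 & z = a *: z'.
Proof.
move=> zm zm' E; have s0 := zscale_gt0 zm; have s0' := zscale_gt0 zm'.
have M0 := prodre_gt0 zm; have N0 := lt_le_trans M0 (znorm2_ge z m).
have M0' := prodre_gt0 zm'; have N0' := lt_le_trans M0' (znorm2_ge z' m).
have MN : prodre m z m / znorm2 z = prodre m z' m / znorm2 z'.
  by have := darboux_norm zm; rewrite E darboux_norm// => /addrI/oppr_inj.
have Em : zscale m z * prodre m z m = zscale m z' * prodre m z' m.
  apply/eqP; rewrite -(eqrXn2 (n := 2))// ?mulr_ge0 ?(ltW s0) ?(ltW s0') ?(ltW M0) ?(ltW M0')//.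
  rewrite !exprMn !zscale_sqr//; apply/eqP.
  transitivity (pi^-1 * (prodre m z m / znorm2 z)).
    by move: (pi : R) (pi_gt0 R) => P P0; field; rewrite !gt_eqF.
  by rewrite MN; move: (pi : R) (pi_gt0 R) => P P0; field; rewrite !gt_eqF.
have Ere j : zscale m z * prodre m z j = zscale m z' * prodre m z' j.
  by case: (unliftP m j) => [k ->|->//]; rewrite -!darboux_even E.
have Eim j : zscale m z * prodim m z j = zscale m z' * prodim m z' j.
  case: (unliftP m j) => [k ->|->]; first by rewrite -!darboux_odd E.
  have p0 w : prodim m w m = 0 by rewrite /prodim; ring.
  by rewrite !p0 !mulr0.
have prodE (w : 'rV[R[i]]_3) j : w 0 j * conjc (w 0 m) = Complex (prodre m w j) (prodim m w j).
  rewrite /prodre /prodim /zre /zim; case: (w 0 j) (w 0 m) => [? ?] [? ?] /=.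
  by apply/eqP; rewrite eq_complex /=; apply/andP; split; apply/eqP; ring.
have Ec j : (zscale m z)%:C%C * (z 0 j * conjc (z 0 m)) =
    (zscale m z')%:C%C * (z' 0 j * conjc (z' 0 m)).
  apply/eqP; rewrite !prodE eq_complex !complex_ReM !complex_ImM /= !mul0r !subr0 !addr0.
  by rewrite Ere Eim !eqxx.
pose a := (zscale m z')%:C%C * conjc (z' 0 m) / ((zscale m z)%:C%C * conjc (z 0 m)).
have c0 : (zscale m z)%:C%C * conjc (z 0 m) != 0 :> R[i].
  by rewrite mulf_neq0 ?conjc_eq0// eq_complex /= eqxx andbT gt_eqF.
have c0' : (zscale m z')%:C%C * conjc (z' 0 m) != 0 :> R[i].
  by rewrite mulf_neq0 ?conjc_eq0// eq_complex /= eqxx andbT gt_eqF.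
exists a; first by rewrite mulf_neq0// invr_eq0.
apply/rowP => j; rewrite mxE; apply: (mulIf c0).
by rewrite mulrAC divfK// mulrCA Ec; ring.
Qed.

Lemma hdot_Re z w : complex.Re (hdot z w) = \sum_j (zre z j * zre w j + zim z j * zim w j).
Proof.
rewrite /hdot /zre /zim !big_ord_recl !big_ord0 !addr0.
case: (z 0 _) (z 0 _) (z 0 _) (w 0 _) (w 0 _) (w 0 _) => [? ?] [? ?] [? ?] [? ?] [? ?] [? ?] /=.
by ring.
Qed.

Lemma hdot_Im z w : complex.Im (hdot z w) = \sum_j (zre z j * zim w j - zim z j * zre w j).
Proof.
rewrite /hdot /zre /zim !big_ord_recl !big_ord0 !addr0.
case: (z 0 _) (z 0 _) (z 0 _) (w 0 _) (w 0 _) (w 0 _) => [? ?] [? ?] [? ?] [? ?] [? ?] [? ?] /=.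
by ring.
Qed.

Lemma fubini_studyE z u v : fubini_study z u v =
  (znorm2 z * complex.Im (hdot u v) - (complex.Re (hdot z u) * complex.Im (hdot z v) -
    complex.Im (hdot z u) * complex.Re (hdot z v))) / znorm2 z ^+ 2 / pi.
Proof.
have uz_re : complex.Re (hdot u z) = complex.Re (hdot z u).
  by rewrite !hdot_Re; apply: eq_bigr => j _; ring.
have uz_im : complex.Im (hdot u z) = - complex.Im (hdot z u).
  by rewrite !hdot_Im -sumrN; apply: eq_bigr => j _; ring.
have zz : hdot z z = (znorm2 z)%:C%C.
  apply/eqP; rewrite eq_complex hdot_Re hdot_Im /= eqxx /=.
  by apply/eqP; rewrite big1// => j _; rewrite mulrC subrr.
rewrite /fubini_study zz -rmorphXn -fmorphV complex_ImM /= mulr0 add0r.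
congr (_ / _ / _).
have -> : complex.Im ((znorm2 z)%:C%C * hdot u v - hdot u z * hdot z v) =
    complex.Im ((znorm2 z)%:C%C * hdot u v) - complex.Im (hdot u z * hdot z v).
  by case: ((znorm2 z)%:C%C * hdot u v) (hdot u z * hdot z v) => [? ?] [? ?].
rewrite !complex_ImM /= mul0r addr0 uz_re uz_im; congr (_ - _); ring.
Qed.

(* First order variations of the previous quantities in the direction [u]. *)
Definition dznorm2 z u : R := \sum_j (zre z j * zre u j + zre z j * zre u j +
  (zim z j * zim u j + zim z j * zim u j)).
(** Left unsimplified: these are literally the expressions that [has_derivD], [has_derivM] and
    [has_deriv_rsqrt] produce, so [darboux_has_deriv] can apply those rules directly. *)
Definition dprodre m z u j : R :=
  zre z j * zre u m + zre z m * zre u j + (zim z j * zim u m + zim z m * zim u j).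
Definition dprodim m z u j : R :=
  zim z j * zre u m + zre z m * zim u j - (zre z j * zim u m + zim z m * zre u j).
Definition dzscale m z u : R := - (2^-1 * zscale m z ^+ 3) *
  (pi * (znorm2 z * dprodre m z u m + prodre m z m * dznorm2 z u)).
Definition ddarboux m z u : 'rV[R]_4 := \row_(k < 4)
  let j := lift m (inord k./2 : 'I_2) in
  if odd k then zscale m z * dprodim m z u j + prodim m z j * dzscale m z u
  else zscale m z * dprodre m z u j + prodre m z j * dzscale m z u.

Lemma ddarboux_even m z u (j : 'I_2) : ddarboux m z u 0 (inord j.*2) =
  zscale m z * dprodre m z u (lift m j) + prodre m z (lift m j) * dzscale m z u.
Proof.
rewrite mxE inordK; last by case: j => [[|[|]]].
by rewrite odd_double doubleK inord_val.
Qed.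

Lemma ddarboux_odd m z u (j : 'I_2) : ddarboux m z u 0 (inord j.*2.+1) =
  zscale m z * dprodim m z u (lift m j) + prodim m z (lift m j) * dzscale m z u.
Proof.
rewrite mxE inordK; last by case: j => [[|[|]]].
by rewrite /= odd_double /= uphalf_double inord_val.
Qed.

Lemma omega0E (u v : 'rV[R]_4) : omega0 u v = \sum_(j < 2)
  (u 0 (inord j.*2) * v 0 (inord j.*2.+1) - u 0 (inord j.*2.+1) * v 0 (inord j.*2)).
Proof. by rewrite !big_ord_recl big_ord0 addr0. Qed.

Lemma darboux_symplectic m z u v : z 0 m != 0 ->
  omega0 (ddarboux m z u) (ddarboux m z v) = fubini_study z u v.
Proof.
move=> zm; have M0 := prodre_gt0 zm; have N0 := lt_le_trans M0 (znorm2_ge z m).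
set s := zscale m z; set M := prodre m z m in M0 *; set N := znorm2 z in N0 *.
have s2 : s ^+ 2 = (pi * (N * M))^-1 := zscale_sqr zm.
(* Logarithmic derivative of [zscale]; it lets the common factor [s] come out of all the
   derivatives. *)
pose lam w := - (dprodre m z w m / M + dznorm2 z w / N) / 2.
have dsE w : dzscale m z w = s * lam w.
  rewrite /dzscale -/s -/M -/N exprSr s2 /lam.
  by move: (pi : R) (pi_gt0 R) => P P0; field; rewrite !gt_eqF.
pose U w j := dprodre m z w j + prodre m z j * lam w.
pose V w j := dprodim m z w j + prodim m z j * lam w.
(* The term [j = m] vanishes because [z_m conj z_m] is real. The sum over the two remaining
   coordinates thus extends to all three, where hermitian products can be recognised. *)
have -> : omega0 (ddarboux m z u) (ddarboux m z v) =
    s ^+ 2 * \sum_j (U u j * V v j - V u j * U v j).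
  rewrite omega0E (bigD1_ord m)//= mulrDr.
  have V0 w : V w m = 0 by rewrite /V /dprodim /prodim; ring.
  rewrite !V0 mulr0 mul0r subrr mulr0 add0r mulr_sumr; apply: eq_bigr => j _.
  rewrite !ddarboux_even !ddarboux_odd !dsE /U /V -/s; ring.
rewrite s2 fubini_studyE.
pose xi := complex.Im (hdot u v).
pose a := complex.Re (hdot z u); pose b := complex.Im (hdot z u).
pose c := complex.Re (hdot z v); pose d := complex.Im (hdot z v).
rewrite -/xi -/a -/b -/c -/d -/N.
pose p := zre z m; pose q := zim z m.
pose u1 := zre u m; pose u2 := zim u m; pose v1 := zre v m; pose v2 := zim v m.
have ME : M = p * p + q * q by [].
have luE : lam u = - ((p * u1 + q * u2) / M + a / N).
  rewrite /lam (_ : dznorm2 z u = 2 * a); last first.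
    by rewrite /dznorm2 /a hdot_Re mulr_sumr; apply: eq_bigr => j _; ring.
  rewrite /dprodre -/p -/q -/u1 -/u2; field.
  by rewrite !gt_eqF.
have lvE : lam v = - ((p * v1 + q * v2) / M + c / N).
  rewrite /lam (_ : dznorm2 z v = 2 * c); last first.
    by rewrite /dznorm2 /c hdot_Re mulr_sumr; apply: eq_bigr => j _; ring.
  rewrite /dprodre -/p -/q -/v1 -/v2; field.
  by rewrite !gt_eqF.
(* A polynomial identity in which [lam u] and [lam v] are free variables. Their values, with
   denominators, enter only in the last [field]. *)
have -> : \sum_j (U u j * V v j - V u j * U v j) = M * xi
   + (- (a * (p * v2 - q * v1)) - b * (p * v1 + q * v2 + lam v * M))
   + (c * (p * u2 - q * u1) + d * (p * u1 + q * u2 + lam u * M))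
   + N * ((u2 + lam u * q) * (v1 + lam v * p) - (u1 + lam u * p) * (v2 + lam v * q)).
  rewrite /xi /a /b /c /d /N /znorm2 !hdot_Re !hdot_Im ME.
  rewrite /U /V /dprodre /dprodim /prodre /prodim -/p -/q -/u1 -/u2 -/v1 -/v2.
  clear luE lvE ME; clearbody p q u1 u2 v1 v2; move: (lam u) (lam v) => lu lv.
  rewrite !big_ord_recl !big_ord0; ring.
rewrite luE lvE ME; move: (pi : R) (pi_gt0 R) => P P0; field.
by rewrite -ME !gt_eqF.
Qed.

End Darboux.

(** * Strict derivatives as functions of the direction *)

Section HasDeriv.
Context {R : realType} {n : nat}.
Implicit Types (h k : 'rV[R]_n -> R) (x u : 'rV[R]_n) (D : 'rV[R]_n -> R).

Definition has_deriv h x D := exists2 l, strict_deriv h x l & forall u, pairing u l = D u.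

Lemma has_deriv_cst a x : has_deriv (fun=> a) x (fun=> 0).
Proof. by exists 0; [exact: strict_deriv_cst|exact: pairing0]. Qed.

Lemma has_derivD h k x D D' : has_deriv h x D -> has_deriv k x D' ->
  has_deriv (fun y => h y + k y) x (fun u => D u + D' u).
Proof.
move=> [l hl lD] [l' kl' lD']; exists (l + l'); first exact: strict_derivD.
by move=> u; rewrite pairingD lD lD'.
Qed.

Lemma has_derivM h k x D D' : has_deriv h x D -> has_deriv k x D' ->
  has_deriv (fun y => h y * k y) x (fun u => h x * D' u + k x * D u).
Proof.
move=> [l hl lD] [l' kl' lD']; exists (h x *: l' + k x *: l); first exact: strict_derivM.
by move=> u; rewrite pairingD !pairingZ lD lD'.
Qed.

Lemma has_derivZ a h x D : has_deriv h x D ->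
  has_deriv (fun y => a * h y) x (fun u => a * D u).
Proof.
move=> hD; have [l hl lD] := has_derivM (has_deriv_cst a x) hD.
by exists l => // u; rewrite lD mulr0 addr0.
Qed.

Lemma has_derivB h k x D D' : has_deriv h x D -> has_deriv k x D' ->
  has_deriv (fun y => h y - k y) x (fun u => D u - D' u).
Proof.
move=> hD kD'; have [l hl lD] := has_derivD hD (has_derivZ (-1) kD').
exists l; last by move=> u; rewrite lD mulN1r.
by move: hl; under [X in strict_deriv X]eq_fun do rewrite mulN1r.
Qed.

Lemma has_deriv_sum (I : Type) (r : seq I) (h : I -> 'rV[R]_n -> R) x (D : I -> 'rV[R]_n -> R) :
  (forall i, has_deriv (h i) x (D i)) ->
  has_deriv (fun y => \sum_(i <- r) h i y) x (fun u => \sum_(i <- r) D i u).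
Proof.
move=> hD; elim: r => [|i r IH].
  have [l hl lD] := has_deriv_cst 0 x; exists l; last by move=> u; rewrite big_nil lD.
  by rewrite (_ : (fun y => _) = fun=> 0)//; apply/funext => y; rewrite big_nil.
have [l hl lD] := has_derivD (hD i) IH; exists l; last by move=> u; rewrite big_cons lD.
by rewrite (_ : (fun y => _) = fun y => h i y + \sum_(i <- r) h i y)//; apply/funext => y; rewrite big_cons.
Qed.

Lemma has_deriv_rsqrt h x D : has_deriv h x D -> 0 < h x ->
  has_deriv (fun y => (Num.sqrt (h y))^-1) x
    (fun u => - (2^-1 * (Num.sqrt (h x))^-1 ^+ 3) * D u).
Proof.
move=> [l hl lD] hx; exists (- (2^-1 * (Num.sqrt (h x))^-1 ^+ 3) *: l).
  exact: strict_deriv_rsqrt.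
by move=> u; rewrite pairingZ lD.
Qed.

Lemma has_deriv_near_cst h x D a : (\forall y \near x, h y = a) -> has_deriv h x D ->
  forall u, D u = 0.
Proof.
move=> /nbhs_ballP[d /= d0 ha] [l hl lD] u; rewrite -lD.
have [->|u0] := eqVneq u 0; first by rewrite /pairing mul0mx mxE.
have nu : 0 < `|u| by rewrite normr_gt0.
apply/eqP; rewrite -normr_eq0; apply/eqP/le_anti; rewrite normr_ge0 andbT.
apply/ler_addgt0Pl => e e0; rewrite addr0.
have eu : 0 < e / `|u| by rewrite divr_gt0.
have [d1 d10 H] := hl _ eu.
pose t := Num.min d d1 / 2 / `|u|.
have m0 : 0 < Num.min d d1 by rewrite lt_min d0.
have t0 : 0 < t by rewrite !divr_gt0.
have tu : `|t *: u| < Num.min d d1.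
  by rewrite normrZ gtr0_norm// divfK ?gt_eqF//; lra.
have bx : ball x (Num.min d d1) (x + t *: u).
  by rewrite -ball_normE /ball_ /= opprD addNKr normrN.
clearbody t.
have bxx : ball x (Num.min d d1) x by exact: ballxx.
have bm d' : Num.min d d1 <= d' -> ball x d' (x + t *: u) /\ ball x d' x.
  by move=> h'; split; [exact: ballW bx|exact: ballW bxx].
have [b1 b2] : ball x d (x + t *: u) /\ ball x d x by apply: bm; rewrite ge_min lexx.
have [b3 b4] : ball x d1 (x + t *: u) /\ ball x d1 x by apply: bm; rewrite ge_min lexx orbT.
have := H _ _ b3 b4; rewrite !ha// subrr sub0r normrN addrAC subrr add0r.
have -> : pairing (t *: u) l = t * pairing u l by rewrite /pairing -scalemxAl mxE.
by rewrite normrM normrZ (gtr0_norm t0) mulrCA divfK ?gt_eqF// ler_pM2l.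
Qed.

Lemma has_deriv_coord x (i : 'I_n) : has_deriv (fun y : 'rV[R]_n => y 0 i) x (fun u => u 0 i).
Proof.
exists (delta_mx i 0) => [e e0|u]; last by rewrite /pairing -colE mxE.
exists 1 => // y z _ _; rewrite /pairing -colE !mxE subrr normr0.
by apply: mulr_ge0 => //; exact: ltW.
Qed.

Lemma sumsq_near x (e : R) : 0 < e ->
  \forall y \near x, `|\sum_i (y : 'rV[R]_n) 0 i ^+ 2 - \sum_i x 0 i ^+ 2| <= e.
Proof.
move=> e0; have [l hl _] := @has_deriv_sum _ (index_enum 'I_n) (fun i y => y 0 i * y 0 i) x _
  (fun i => has_derivM (has_deriv_coord x i) (has_deriv_coord x i)).
have [d d0 H] := strict_deriv_near_eq hl e0.
by apply/nbhs_ballP; exists d.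
Qed.

End HasDeriv.

(** * Linear algebra of the standard symplectic form *)

Section SymplecticLinear.
Context {R : realType}.

Lemma big_ord4 (F : 'I_4 -> R) :
  \sum_i F i = F (inord 0) + F (inord 1) + (F (inord 2) + F (inord 3)).
Proof.
rewrite !big_ord_recl big_ord0 addr0 !addrA; congr (F _ + F _ + F _ + F _).
all: by apply/val_inj; rewrite /= ?inordK.
Qed.

(** Gram matrix of [omega0]: the condition [odd j && (i.+1 == j)] selects the pairs (0, 1) and (2,
    3) but not (1, 2). *)
Definition omega_mx : 'M[R]_4 := \matrix_(i, j)
  ((odd j && (i.+1 == j :> nat))%:R - (odd i && (j.+1 == i :> nat))%:R).

Lemma omega_mxE (u v : 'rV[R]_4) : omega0 u v = (u *m omega_mx *m v^T) 0 0.
Proof.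
rewrite mxE big_ord4 !mxE !big_ord4 !mxE !inordK//= /omega0.
ring.
Qed.

Lemma omega_mx_unit : omega_mx \in unitmx.
Proof.
have /mulmx1_unit[] // : omega_mx *m - omega_mx = 1%:M.
apply/matrixP => i j; rewrite mxE big_ord4 !mxE !inordK//=.
case: i => [[|[|[|[|//]]]] ?]; case: j => [[|[|[|[|//]]]] ?] /=; ring.
Qed.

Lemma omega0_nondeg (u : 'rV[R]_4) : (forall v, omega0 u v = 0) -> u = 0.
Proof.
move=> h; rewrite -[u](mulmxK omega_mx_unit) (_ : u *m omega_mx = 0) ?mul0mx//.
apply/rowP => j; have := h (delta_mx 0 j); rewrite omega_mxE trmx_delta -colE !mxE.
by [].
Qed.

(** Invariance reads [T *m omega_mx *m T^T = omega_mx]; taking determinants gives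
    [(\det T) ^+ 2 = 1]. *)
Lemma symplectic_det (T : 'M[R]_4) :
  (forall u v, omega0 (u *m T) (v *m T) = omega0 u v) -> `|\det T| = 1.
Proof.
move=> h; have E : T *m omega_mx *m T^T = omega_mx.
  apply/matrixP => i j; have := h (delta_mx 0 i) (delta_mx 0 j).
  rewrite !omega_mxE trmx_mul !trmx_delta !mulmxA -!rowE.
  have rc (A : 'M[R]_4) : (row i (col j A)) 0 0 = A i j by rewrite !mxE.
  by rewrite -!row_mul -!colE !rc.
have J0 : \det omega_mx != 0 by rewrite -unitfE -unitmxE omega_mx_unit.
have := congr1 determinant E; rewrite !det_mulmx det_tr mulrAC -[RHS]mul1r => /(mulIf J0).
by move=> /eqP; rewrite -expr2 sqrf_eq1 => /orP[]/eqP ->; rewrite ?normrN normr1.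
Qed.

End SymplecticLinear.

(** * Symplectic maps into the projective plane, seen in Darboux coordinates *)

Section Embeddings.
Context {R : realType}.
Implicit Types (f : 'rV[R]_4 -> @CP2 R) (x y u v : 'rV[R]_4) (k m : 'I_3).

Lemma darboux_chartE k m (P : @CP2 R) : affine_dom k P ->
  darboux_chart m P = darboux m (affine_coord k P).
Proof. by move=> Pk; rewrite /affine_coord darboux_scale// invr_eq0. Qed.

Lemma affine_domE k m (P : @CP2 R) : affine_dom k P ->
  affine_dom m P <-> affine_coord k P 0 m != 0.
Proof.
by move=> Pk; rewrite /affine_coord mxE mulf_eq0 invr_eq0 negb_or [_ != 0]Pk.
Qed.

Lemma affine_coord_diag k (P : @CP2 R) : affine_dom k P -> affine_coord k P 0 k = 1.
Proof. by move=> Pk; rewrite mxE mulVf. Qed.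

Lemma CP2_line (P : @CP2 R) : val P = <[vpick (val P)]>%VS.
Proof.
have P0 : vpick (val P) != 0 by rewrite vpick0 -dimv_eq0 (eqP (valP P)).
apply/esym/eqP; rewrite eqEdim -memvE memv_pick dim_vline P0.
by rewrite (eqP (valP P)).
Qed.

Lemma CP2_eq (P Q : @CP2 R) a : a != 0 -> vpick (val P) = a *: vpick (val Q) -> P = Q.
Proof.
move=> a0 E; apply/val_inj; rewrite CP2_line [RHS]CP2_line E.
apply/eqP; rewrite eqEsubv -!memvE memvZ ?memv_line//=.
by rewrite -{1}[vpick (val Q)](scalerK a0) memvZ// memv_line.
Qed.

Lemma darboux_chart_inj m (P Q : @CP2 R) : affine_dom m P -> affine_dom m Q ->
  darboux_chart m P = darboux_chart m Q -> P = Q.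
Proof. by move=> Pm Qm /(darboux_inj Pm Qm)[a a0] /(CP2_eq a0). Qed.

Lemma darboux_chart_ball m (P : @CP2 R) : affine_dom m P ->
  closed_ball4 1 (darboux_chart m P).
Proof.
move=> Pm; rewrite /closed_ball4 /= darboux_norm// gerBl divr_ge0//.
  exact/ltW/prodre_gt0.
by rewrite (le_trans (ltW (prodre_gt0 Pm)))// znorm2_ge.
Qed.

Lemma smooth_on_has_deriv (V : set 'rV[R]_4) (g : 'rV[R]_4 -> R) x : open V -> V x ->
  smooth_on V g -> has_deriv g x (fun u => 'D_u g x).
Proof.
move=> oV Vx sg; exists (\col_i 'D_(delta_mx 0 i) g x); first exact: (smooth_strict_deriv oV Vx sg).
have dg : differentiable g x by exact: (sg [::]).
move=> u; rewrite pairingE deriveE// {2}(row_sum_delta u) linear_sum.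
by apply: eq_bigr => i _; rewrite linearZ /= mxE deriveE.
Qed.

Definition chart_at f x k :=
  (\forall y \near x, affine_dom k (f y)) /\
  (forall j, has_deriv (fun y => zre (affine_coord k (f y)) j) x
      (fun u => zre (deriv_chart f k x u) j) /\
    has_deriv (fun y => zim (affine_coord k (f y)) j) x
      (fun u => zim (deriv_chart f k x u) j)).

Lemma smooth_at_chart f x : smooth_at f x -> exists k, chart_at f x k.
Proof.
move=> [k [V [oV Vx Vk sV]]]; exists k; split.
  by apply: filterS Vk _; exact: open_nbhs_nbhs.
move=> j; have [sr si] := sV j; rewrite /zre /zim; split.
  have [l hl lD] := smooth_on_has_deriv oV Vx sr; exists l => // u.
  by rewrite lD mxE.
have [l hl lD] := smooth_on_has_deriv oV Vx si; exists l => // u.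
by rewrite lD mxE.
Qed.

Lemma chart_at_dom f x k : chart_at f x k -> affine_dom k (f x).
Proof. by move=> [/nbhs_singleton]. Qed.

(** Openness is read in the chart [k] where [f] is known to be smooth: [|z_m|^2] is strictly
    differentiable there, so near [x] it stays above half its value. *)
Lemma near_affine_dom f x k m : chart_at f x k -> affine_dom m (f x) ->
  \forall y \near x, affine_dom m (f y).
Proof.
move=> ck fm; have [nk H] := ck; have fk := chart_at_dom ck.
have zm : affine_coord k (f x) 0 m != 0 by apply/affine_domE.
have M0 := prodre_gt0 zm; have [Hre Him] := H m.
have [l hl _] := has_derivD (has_derivM Hre Hre) (has_derivM Him Him).
have M2 : 0 < prodre m (affine_coord k (f x)) m / 2 by rewrite divr_gt0.
have [d d0 Hd] := strict_deriv_near_eq hl M2.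
have nd : \forall y \near x, ball x d y by exact: nbhsx_ballx.
apply: filterS2 nk nd => y yk yd.
have yM : `|prodre m (affine_coord k (f y)) m - prodre m (affine_coord k (f x)) m| <=
    prodre m (affine_coord k (f x)) m / 2 by exact: Hd yd.
apply/(affine_domE m yk); rewrite complex_neq0 -/(prodre m (affine_coord k (f y)) m).
move: yM M0; move: (prodre m _ m) (prodre m (affine_coord k (f y)) m) => a b.
by rewrite ler_norml => /andP[ab _] a0; lra.
Qed.

Lemma darboux_has_deriv f x k m i : chart_at f x k -> affine_dom m (f x) ->
  has_deriv (fun y => darboux_chart m (f y) 0 i) x
    (fun u => ddarboux m (affine_coord k (f x)) (deriv_chart f k x u) 0 i).
Proof.
move=> ck fm; have [nk H] := ck; have fk := chart_at_dom ck.
have zm : affine_coord k (f x) 0 m != 0 by apply/affine_domE.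
set z := fun y => affine_coord k (f y).
have Hre j : has_deriv (fun y => zre (z y) j) x (fun u => zre (deriv_chart f k x u) j) := (H j).1.
have Him j : has_deriv (fun y => zim (z y) j) x (fun u => zim (deriv_chart f k x u) j) := (H j).2.
have Hpr j : has_deriv (fun y => prodre m (z y) j) x
    (fun u => dprodre m (z x) (deriv_chart f k x u) j).
  exact: has_derivD (has_derivM (Hre j) (Hre m)) (has_derivM (Him j) (Him m)).
have Hpi j : has_deriv (fun y => prodim m (z y) j) x
    (fun u => dprodim m (z x) (deriv_chart f k x u) j).
  exact: has_derivB (has_derivM (Him j) (Hre m)) (has_derivM (Hre j) (Him m)).
have HN : has_deriv (fun y => znorm2 (z y)) x (fun u => dznorm2 (z x) (deriv_chart f k x u)).
  apply: (@has_deriv_sum _ _ _ _ (fun j y => zre (z y) j * zre (z y) j + zim (z y) j * zim (z y) j)) => j.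
  exact: has_derivD (has_derivM (Hre j) (Hre j)) (has_derivM (Him j) (Him j)).
have Hs : has_deriv (fun y => zscale m (z y)) x (fun u => dzscale m (z x) (deriv_chart f k x u)).
  apply: has_deriv_rsqrt (has_derivZ pi (has_derivM HN (Hpr m))) _.
  have M0 := prodre_gt0 zm.
  by rewrite !mulr_gt0 ?pi_gt0// (lt_le_trans M0)// znorm2_ge.
have E : \forall y \near x, zscale m (z y) * (if odd i then prodim m (z y) (lift m (inord i./2 : 'I_2))
    else prodre m (z y) (lift m (inord i./2 : 'I_2))) = darboux_chart m (f y) 0 i.
  by apply: filterS nk => y yk; rewrite (darboux_chartE m yk) mxE.
have [l hl lD] : has_deriv (fun y => zscale m (z y) * (if odd i then prodim m (z y) (lift m (inord i./2 : 'I_2))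
    else prodre m (z y) (lift m (inord i./2 : 'I_2)))) x
    (fun u => ddarboux m (affine_coord k (f x)) (deriv_chart f k x u) 0 i).
  have [oi|ei] := boolP (odd i).
    have [l hl lD] := has_derivM Hs (Hpi (lift m (inord i./2 : 'I_2))).
    by exists l => // u; rewrite lD mxE /= oi.
  have [l hl lD] := has_derivM Hs (Hpr (lift m (inord i./2 : 'I_2))).
  by exists l => // u; rewrite lD mxE /= (negbTE ei).
by exists l => //; exact: strict_deriv_near E hl.
Qed.

Lemma regular_point f x m : smooth_at f x -> symplectic_at f x -> affine_dom m (f x) ->
  exists2 T : 'M[R]_4, `|\det T| = 1 & strict_deriv_mx (fun y => darboux_chart m (f y)) x T.
Proof.
move=> /smooth_at_chart[k ck] sy fm; have fk := chart_at_dom ck.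
have zm : affine_coord k (f x) 0 m != 0 by apply/affine_domE.
have /all_sig2[l hl lD] : forall i, {l | strict_deriv (fun y => darboux_chart m (f y) 0 i) x l &
    forall u, pairing u l = ddarboux m (affine_coord k (f x)) (deriv_chart f k x u) 0 i}.
  by move=> i; apply: cid2; exact: darboux_has_deriv.
pose T : 'M[R]_4 := \matrix_(i, j) l j i 0; exists T; last first.
  move=> j; rewrite (_ : col j T = l j)//.
  by apply/colP => i; rewrite !mxE.
apply: symplectic_det => u v.
have TE w : w *m T = ddarboux m (affine_coord k (f x)) (deriv_chart f k x w).
  apply/rowP => j; rewrite -lD pairingE mxE.
  by apply: eq_bigr => i _; rewrite mxE.
by rewrite !TE darboux_symplectic// sy.
Qed.

Lemma third_index k m : k != m -> exists j, forall i, [|| i == j, i == k | i == m].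
Proof.
move=> km; have /eqP/cards1P[j jE] : #|~: [set k; m]%SET| = 1%N.
  by rewrite cardsCs finset.setCK cards2 km card_ord.
exists j => i; have : (i \in ~: [set k; m]%SET) = (i == j) by rewrite jE inE.
by rewrite !inE => <-; case: (i == k) (i == m) => [] [].
Qed.

(** If both the real and the imaginary part of [z_m] had zero derivative at [x], then, [z_k] being
    constantly 1, only one complex coordinate could vary. The derivative would have a kernel in
    dimension 4, against the nondegeneracy of [omega0]. *)
Lemma line_point f x m : smooth_at f x -> symplectic_at f x -> ~ affine_dom m (f x) ->
  exists h l i, [/\ strict_deriv h x l, l i 0 != 0 &
    \forall y \near x, ~ affine_dom m (f y) -> h y = 0].
Proof.
move=> /smooth_at_chart[k ck] sy fm; have fk := chart_at_dom ck; have [nk H] := ck.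
have zm : affine_coord k (f x) 0 m = 0.
  by apply/eqP; apply: contrapT => /negP h; apply/fm/(affine_domE m fk).
have km : k != m.
  by apply/negP => /eqP E; move: zm; rewrite -E affine_coord_diag// => /eqP; rewrite oner_eq0.
pose z := fun y => affine_coord k (f y).
have [[lr hlr lrD] [li hli liD]] := H m.
have zero y : affine_dom k (f y) -> ~ affine_dom m (f y) -> zre (z y) m = 0 /\ zim (z y) m = 0.
  move=> yk /(affine_domE m yk) => /negP; rewrite negbK => /eqP E.
  by rewrite /zre /zim /z E.
have [|/existsPn lr0] := boolP [exists i, lr i 0 != 0].
  move=> /existsP[i lri]; exists (fun y => zre (z y) m), lr, i; split => //.
  by apply: filterS nk => y yk /(zero y yk)[].
have [|/existsPn li0] := boolP [exists i, li i 0 != 0].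
  move=> /existsP[i lii]; exists (fun y => zim (z y) m), li, i; split => //.
  by apply: filterS nk => y yk /(zero y yk)[].
exfalso.
have Um u : deriv_chart f k x u 0 m = 0.
  apply/eqP; rewrite eq_complex -[complex.Re _]/(zre _ _) -[complex.Im _]/(zim _ _).
  rewrite -lrD -liD !pairingE !big1 ?eqxx// => i _.
    by have := li0 i; rewrite negbK => /eqP ->; rewrite mulr0.
  by have := lr0 i; rewrite negbK => /eqP ->; rewrite mulr0.
have Uk u : deriv_chart f k x u 0 k = 0.
  apply/eqP; rewrite eq_complex -[complex.Re _]/(zre _ _) -[complex.Im _]/(zim _ _).
  have [hr hi] := H k.
  rewrite (has_deriv_near_cst (a := 1) _ hr) ?(has_deriv_near_cst (a := 0) _ hi) ?eqxx//.
    by apply: filterS nk => y yk; rewrite /zim affine_coord_diag.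
  by apply: filterS nk => y yk; rewrite /zre affine_coord_diag.
have [j jP] := third_index km.
have [[jr _ jrD] [ji _ jiD]] := H j.
(* The two real derivatives of the remaining coordinate [j] form a 4 by 2 matrix, so a nonzero
   vector is killed by both. *)
pose M := row_mx jr ji.
have : kermx M != 0.
  rewrite -mxrank_eq0 mxrank_ker subn_eq0 -ltnNge.
  by rewrite (leq_ltn_trans (rank_leq_col M)).
move=> /rowV0Pn[u /sub_kermxP uM u0].
have Uj : deriv_chart f k x u 0 j = 0.
  apply/eqP; rewrite eq_complex -[complex.Re _]/(zre _ _) -[complex.Im _]/(zim _ _).
  move: uM; rewrite /M mul_mx_row -row_mx0 => /eq_row_mx[E1 E2].
  by rewrite -jrD -jiD /pairing E1 E2 mxE eqxx.
have U0 : deriv_chart f k x u = 0.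
  apply/rowP => i; have /or3P[/eqP->|/eqP->|/eqP->] := jP i.
  - by rewrite Uj mxE.
  - by rewrite Uk mxE.
  - by rewrite Um mxE.
move/negP: u0; apply; apply/eqP/omega0_nondeg => v.
rewrite -(sy k fk) U0 /fubini_study.
have h0 w : hdot 0 w = 0 :> R[i].
  by rewrite /hdot big1// => i _; rewrite mxE conjc0 mul0r.
by rewrite !h0 mulr0 mul0r subrr !mul0r.
Qed.

End Embeddings.

(** * Closed balls and the content of the ball of capacity 1 *)

Section BallVolume.
Context {R : realType}.
Implicit Types (x y z c : 'rV[R]_4) (m k : 'I_3).

Lemma closed_ball4_coord (d : R) x i : closed_ball4 d x -> x 0 i ^+ 2 <= d / pi.
Proof.
rewrite /closed_ball4 /= ler_pdivlMr ?pi_gt0//; apply: le_trans.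
rewrite [leLHS]mulrC ler_pM2l ?pi_gt0// (bigD1 i)//= lerDl sumr_ge0// => j _.
exact: sqr_ge0.
Qed.

Lemma closed_ball4_sub_cube : closed_ball4 1 `<=` ball (0 : 'rV[R]_4) 1.
Proof.
move=> x /closed_ball4_coord xi; apply/ball01P => i.
have p1 : 1 / pi < 1 :> R by rewrite ltr_pdivrMr ?pi_gt0// mul1r (lt_le_trans _ (pi_ge2 R))// ltr1n.
rewrite ltNge; apply/negP => h; have := le_lt_trans (xi i) p1.
by rewrite -real_normK ?num_real// ltNge exprn_ege1.
Qed.

Lemma closed_ball4_closed (d : R) : closed (closed_ball4 d).
Proof.
move=> x xcl; apply: contrapT => /negP; rewrite -ltNge => xd.
pose G (y : 'rV[R]_4) := \sum_i y 0 i ^+ 2.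
have e0 : 0 < (pi * G x - d) / (2 * pi) by rewrite divr_gt0 ?mulr_gt0 ?pi_gt0// subr_gt0.
have [y [yd]] := xcl _ (sumsq_near x e0).
rewrite -/(G y) -/(G x) ler_norml => /andP[+ _]; rewrite lerNl opprB ler_pdivlMr ?mulr_gt0 ?pi_gt0//.
move: yd xd; rewrite /closed_ball4 /= -/(G y) -/(G x); move: (G x) (G y) => a b; lra.
Qed.

Lemma closed_ball4_compact (d : R) : compact (closed_ball4 d).
Proof.
apply: bounded_closed_compact; last exact: closed_ball4_closed.
have [d0|d0] := ltP d 0.
  exists 0; split; first exact: num_real.
  move=> M M0 x /(closed_ball4_coord 0) h; exfalso; move: (le_trans (sqr_ge0 _) h).
  by rewrite leNgt ltr_pdivrMr ?pi_gt0// mul0r d0.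
exists (d / pi + 1); split; first exact: num_real.
move=> M dM x /closed_ball4_coord xd; have dp : 0 <= d / pi by rewrite divr_ge0// pi_ge0.
have M0 : 0 <= M by rewrite ltW// (le_lt_trans _ dM)// addr_ge0.
apply/rV_norm_le => // i; rewrite -(ler_pXn2r (n := 2))// ?nnegrE// real_normK ?num_real//.
apply: le_trans (xd i) _; set q := d / pi in dM dp *.
have : q + 1 <= M by rewrite ltW.
by move=> qM; rewrite expr2; nra.
Qed.

Lemma closed_ball4_cball (d : R) c r : 0 < r -> ball c r `<=` closed_ball4 d ->
  cball c r `<=` closed_ball4 d.
Proof.
move=> r0 /closure_subset; rewrite closure_ballE -cball_closed_ball//.
by rewrite -((closure_id _).1 (@closed_ball4_closed d)).
Qed.

Definition unit_ball_vol : R := sup [set t | packed (closed_ball4 1 : set 'rV[R]_4) t].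

Lemma unit_ball_has_sup : has_sup [set t | packed (closed_ball4 1 : set 'rV[R]_4) t].
Proof.
split; first by exists 0; exact: packed0.
exists (2 ^+ 4) => t /packed_bounded; apply; exact: closed_ball4_sub_cube.
Qed.

Lemma unit_ball_vol_ge t : vol_ge (closed_ball4 1 : set 'rV[R]_4) t -> t <= unit_ball_vol.
Proof.
move=> h; rewrite leNgt; apply/negP => /h[s st ps].
have := ub_le_sup unit_ball_has_sup.2 ps; apply/negP; rewrite -ltNge.
exact: st.
Qed.

End BallVolume.

(** * The volume constraint for symplectic ball packings *)

Section Packings.
Context {R : realType}.
Implicit Types (f : 'rV[R]_4 -> @CP2 R) (x y z c : 'rV[R]_4) (m k : 'I_3).

Definition dom_set m f : set 'rV[R]_4 := [set y | affine_dom m (f y)].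

(** In the Darboux chart [m] the derivative has determinant of absolute value 1, so cubes of the
    source keep their content; [dom_set] removes the points mapped to the line [z_m = 0]. *)
Lemma ball_image_vol f m (d t : R) : 0 < d ->
  (forall x, closed_ball4 d x -> smooth_at f x /\ symplectic_at f x) ->
  (forall x y, closed_ball4 d x -> closed_ball4 d y -> f x = f y -> x = y) ->
  packed (closed_ball4 1) t ->
  vol_ge ((fun y => darboux_chart m (f y)) @` (closed_ball4 d `&` dom_set m f)) (d ^+ 2 * t).
Proof.
move=> d0 fs fi pt; set F := fun y => _; set A := dom_set m f; set B := closed_ball4 d.
have inj y z : B y -> B z -> A y -> A z -> F y = F z -> y = z.
  by move=> By Bz Ay Az /(darboux_chart_inj Ay Az)/fi; exact.
have nearA x : B x -> A x -> \forall y \near x, A y.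
  by move=> /fs[/smooth_at_chart[k ck] _] Ax; exact: near_affine_dom ck Ax.
have step1 c r : 0 < r -> cball c r `<=` B -> cball c r `<=` A ->
    vol_ge (F @` (ball c r `&` A)) (r ^+ 4).
  move=> r0 cB cA; apply: vol_ge_cover => // [y z cy cz|x cx].
    exact: inj (cB _ cy) (cB _ cz).
  have [sx yx] := fs _ (cB _ cx); have [T dT ST] := regular_point sx yx (cA _ cx).
  apply: good_cubes_strict dT ST _.
  exact: nearA (cB _ cx) (cA _ cx).
(* The cube may now meet the preimage of the line: at such a point [line_point] supplies the zero
   set, and [step1] serves the cells contained in [A]. *)
have step2 c r : 0 < r -> cball c r `<=` B -> vol_ge (F @` (ball c r `&` A)) (r ^+ 4).
  move=> r0 cB; apply: vol_ge_cover => // [y z cy cz|x cx].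
    exact: inj (cB _ cy) (cB _ cz).
  have [sx yx] := fs _ (cB _ cx); have [Ax|nAx] := pselect (A x).
    have [T dT ST] := regular_point sx yx Ax.
    apply: good_cubes_strict dT ST _.
    exact: nearA (cB _ cx) Ax.
  have [h [l [i [hl li hA]]]] := line_point sx yx nAx.
  apply: (good_cubes_zero_set hl li) hA _ => [y z cy cz|c' r' r'0 c'K c'A].
    exact: inj (cB _ cy) (cB _ cz).
  by apply: step1 => // y /c'K/cB.
(* Capacity is quadratic in the radius: dilation by [sqrt d] takes the ball of capacity 1 into that
   of capacity [d] and multiplies weights by [sqrt d ^+ 4 = d ^+ 2]. *)
have s0 : 0 < Num.sqrt d by rewrite sqrtr_gt0.
have sE : Num.sqrt d ^+ 4 = d ^+ 2 by rewrite (exprM _ 2 2) sqr_sqrtr// ltW.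
have := vol_ge_affine 0 s0 (packed_vol_ge pt); rewrite sE => vt.
rewrite -[_ * t]mul1r.
have sub : [set 0 + Num.sqrt d *: x | x in closed_ball4 1] `<=` B.
  move=> _ [x x1 <-]; rewrite /B /closed_ball4 /= add0r.
  rewrite (eq_bigr (fun i => d * x 0 i ^+ 2)) => [|i _].
    by rewrite -mulr_sumr mulrCA ger_pMr.
  by rewrite mxE exprMn sqr_sqrtr// ltW.
apply: (@vol_geS _ _ (F @` ([set 0 + Num.sqrt d *: x | x in closed_ball4 1] `&` A))).
  by apply: image_subset => y [/sub By Ay].
apply: (@vol_ge_image _ _ F B A 1) vt sub => // c r r0 cB; rewrite mul1r.
by apply: step2 => //; exact: closed_ball4_cball.
Qed.

(** The derivative is invertible with inverse bounded by [C], so equal images within error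
    [1 / (2 C)] force [|z - y| <= |z - y| / 2]. *)
Lemma locally_injective f x : smooth_at f x -> symplectic_at f x ->
  \forall z \near x & y \near x, f z = f y -> z = y.
Proof.
move=> sx yx; have [k ck] := smooth_at_chart sx.
have [T dT ST] := regular_point sx yx (chart_at_dom ck).
have Tu : T \in unitmx by rewrite unitmxE unitfE -normr_eq0 dT oner_eq0.
have [C C0 HC] := mulmx_norm_bound (invmx T).
have e0 : 0 < (2 * C)^-1 by rewrite invr_gt0 mulr_gt0.
have [d d0 H] := strict_deriv_mxP ST e0.
exists (ball x d, ball x d); first by split; exact: nbhsx_ballx.
move=> [z y] [/= xz xy] fzy; have := H z y xz xy; rewrite fzy subrr sub0r normrN => h.
have := HC ((z - y) *m T); rewrite mulmxK// => h2.
have : `|z - y| <= `|z - y| / 2.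
  apply: le_trans h2 _; apply: le_trans (ler_wpM2l (ltW C0) h) _.
  rewrite le_eqVlt; apply/orP; left; apply/eqP; field.
  by rewrite gt_eqF.
rewrite ler_pdivlMr// mulr_natr mulr2n gerDl normr_le0 subr_eq0 => /eqP.
by [].
Qed.

Lemma chart_at_continuous f x k j : chart_at f x k ->
  zre (affine_coord k (f y)) j @[y --> x] --> zre (affine_coord k (f x)) j /\
  zim (affine_coord k (f y)) j @[y --> x] --> zim (affine_coord k (f x)) j.
Proof.
have lim (h : 'rV[R]_4 -> R) l : strict_deriv h x l -> h y @[y --> x] --> h x.
  move=> hl A /nbhs_ballP[e /= e0 eA]; have e2 : 0 < e / 2 by rewrite divr_gt0.
  have [d d0 H] := strict_deriv_near_eq hl e2; apply/nbhs_ballP; exists d => //= y /H hy.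
  apply: eA; rewrite -ball_normE /ball_ /= distrC (le_lt_trans hy)//.
  by rewrite ltr_pdivrMr// ltr_pMr// ltr1n.
by move=> [_ /(_ j)[[l hl _] [l' hl' _]]]; split; [exact: lim hl|exact: lim hl'].
Qed.

(** Separation is witnessed by an equation: with [a] normalised by [a_k = 1], equality of the two
    points forces [b_q = b_k a_q] for every [q]. A failure at [(z, x)] persists nearby, by
    continuity of its real or imaginary part. *)
Lemma separated_images f g x z : smooth_at f x -> smooth_at g z -> f x <> g z ->
  \forall z' \near z & y \near x, g z' <> f y.
Proof.
move=> /smooth_at_chart[k ck] /smooth_at_chart[k' ck'] fg.
have fk := chart_at_dom ck; have gk := chart_at_dom ck'.
pose a y := affine_coord k (f y); pose b z := affine_coord k' (g z).
have [q bq] : exists q, b z 0 q != b z 0 k * a x 0 q.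
  apply/existsP; apply: contrapT => /negP/existsPn h; apply: fg; apply/esym.
  have ba : b z = b z 0 k *: a x.
    by apply/rowP => q; rewrite [RHS]mxE; apply/eqP; have := h q; rewrite negbK.
  have b0 : b z 0 k != 0.
    apply/eqP => b0; have := affine_coord_diag gk; rewrite -/(b z) ba b0 scale0r mxE.
    by move/eqP; rewrite eq_sym oner_eq0.
  apply: (@CP2_eq _ _ _ (vpick (val (g z)) 0 k' * (b z 0 k * (vpick (val (f x)) 0 k)^-1))).
    by rewrite !mulf_neq0// invr_eq0.
  rewrite -!scalerA -/(affine_coord k (f x)) -/(a x) -ba /b /affine_coord scalerA.
  by rewrite mulfV// scale1r.
have par z' y : affine_dom k (f y) -> g z' = f y -> b z' 0 q = b z' 0 k * a y 0 q.
  move=> yk E; rewrite /b /a /affine_coord E !mxE mulrA -[_ * _ * _^-1]mulrA mulfV//.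
  by rewrite mulr1.
have [nk _] := ck.
pose gre (p : 'rV[R]_4 * 'rV[R]_4) := zre (b p.1) q -
  (zre (b p.1) k * zre (a p.2) q - zim (b p.1) k * zim (a p.2) q).
pose gim (p : 'rV[R]_4 * 'rV[R]_4) := zim (b p.1) q -
  (zre (b p.1) k * zim (a p.2) q + zim (b p.1) k * zre (a p.2) q).
have ca j : zre (a p.2) j @[p --> (z, x)] --> zre (a x) j /\
    zim (a p.2) j @[p --> (z, x)] --> zim (a x) j.
  have [c1 c2] := chart_at_continuous j ck; split.
    exact: (cvg_comp _ _ cvg_snd c1).
  exact: (cvg_comp _ _ cvg_snd c2).
have cb j : zre (b p.1) j @[p --> (z, x)] --> zre (b z) j /\
    zim (b p.1) j @[p --> (z, x)] --> zim (b z) j.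
  have [c1 c2] := chart_at_continuous j ck'; split.
    exact: (cvg_comp _ _ cvg_fst c1).
  exact: (cvg_comp _ _ cvg_fst c2).
have cre : gre p @[p --> (z, x)] --> gre (z, x).
  apply: cvgB (cb q).1 _; apply: cvgB; first exact: cvgM (cb k).1 (ca q).1.
  exact: cvgM (cb k).2 (ca q).2.
have cim : gim p @[p --> (z, x)] --> gim (z, x).
  apply: cvgB (cb q).2 _; apply: cvgD; first exact: cvgM (cb k).1 (ca q).2.
  exact: cvgM (cb k).2 (ca q).1.
have nkp : \forall p \near (z, x), affine_dom k (f p.2) by exact: (cvg_snd nk).
have gz p : affine_dom k (f p.2) -> g p.1 = f p.2 -> gre p = 0 /\ gim p = 0.
  move=> pk /(par _ _ pk) E.
  have E1 : zre (b p.1) q = zre (b p.1) k * zre (a p.2) q - zim (b p.1) k * zim (a p.2) q.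
    by move/(congr1 (@complex.Re R)): E; rewrite complex_ReM.
  have E2 : zim (b p.1) q = zre (b p.1) k * zim (a p.2) q + zim (b p.1) k * zre (a p.2) q.
    by move/(congr1 (@complex.Im R)): E; rewrite complex_ImM.
  by split; apply/eqP; rewrite subr_eq0; apply/eqP.
have [gr|/eqP gr] := eqVneq (gre (z, x)) 0; last first.
  have n0 : \forall p \near (z, x), gre p != 0 by apply: cvgr_neq0 cre _; apply/eqP.
  by apply: filterS2 nkp n0 => p pk /eqP n0 E; exact: (n0 (gz p pk E).1).
have gi : gim (z, x) != 0.
  apply: contra bq => /eqP gi; rewrite eq_complex; apply/andP; split; apply/eqP.
    by rewrite complex_ReM; exact: (subr0_eq gr).
  by rewrite complex_ImM; exact: (subr0_eq gi).
have n0 : \forall p \near (z, x), gim p != 0 by apply: cvgr_neq0 cim _.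
by apply: filterS2 nkp n0 => p pk /eqP n0 E; exact: (n0 (gz p pk E).2).
Qed.

(** The embedding is injective on the closed balls, but here [y] may leave ball [i]. Compactness of
    ball [j] localises at each [z]: either [f j z] differs from [f i x] and nearby images separate,
    or [z = x] and local injectivity applies. *)
Lemma images_near_point n (delta : 'rV[R]_n) (f : 'I_n -> 'rV[R]_4 -> @CP2 R) i x :
  symplectic_ball_embedding delta f -> closed_ball4 (delta 0 i) x ->
  \forall y \near x, forall j z, closed_ball4 (delta 0 j) z -> f j z = f i y -> j = i /\ z = y.
Proof.
move=> [fs fi] xi; have [sx yx] := fs _ _ xi.
apply: (@filter_forall _ _ (fun j y => forall z, closed_ball4 (delta 0 j) z -> f j z = f i y ->
  j = i /\ z = y) (nbhs x) _) => j.
have := (compact_near_coveringP _).1 (@closed_ball4_compact R (delta 0 j)) _ _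
  (fun y z => f j z = f i y -> j = i /\ z = y) (nbhs_filter x).
move=> /(_ _); apply=> z zj; have [sz _] := fs _ _ zj.
have [fE|fN] := pselect (f i x = f j z).
  have [ij <-] := fi _ _ _ _ xi zj fE; rewrite -ij.
  by apply: filterS (locally_injective sx yx) => p h /h.
by apply: filterS (separated_images sx sz fN) => p h /h.
Qed.

(** The gain [e] comes from a cube just outside ball [i0], whose image is controlled by the strict
    derivative at the boundary point [x]. As [e] does not depend on [t], it survives the passage to
    the supremum. *)
Lemma admissible_vol n (delta : 'rV[R]_n) : (0 < n)%N -> admissible delta ->
  exists2 e : R, 0 < e & forall t, packed (closed_ball4 1 : set 'rV[R]_4) t ->
    (\sum_i delta 0 i ^+ 2) * t + e <= unit_ball_vol.
Proof.
move=> n0 [d0 [f emb]]; have [fs fi] := emb; pose i0 := Ordinal n0.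
pose x0 := Num.sqrt (delta 0 i0 / pi).
have x00 : 0 < x0 by rewrite sqrtr_gt0 divr_gt0 ?pi_gt0.
have x02 : x0 ^+ 2 = delta 0 i0 / pi by rewrite sqr_sqrtr// ltW// divr_gt0 ?pi_gt0.
pose x : 'rV[R]_4 := x0 *: delta_mx 0 0.
have xB : closed_ball4 (delta 0 i0) x.
  rewrite /closed_ball4 /= (bigD1 0)//= big1 => [|i i1]; last first.
    by rewrite !mxE (negbTE i1) mulr0 expr0n.
  by rewrite !mxE eqxx mulr1 addr0 x02 mulrC divfK// gt_eqF ?pi_gt0.
(* The line to remove is chosen away from the image of [x], so that the extra cube is visible in the
   chart [m]. *)
have [sx yx] := fs _ _ xB; have [m cm] := smooth_at_chart sx.
have fm := chart_at_dom cm; have [T dT ST] := regular_point sx yx fm.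
have Tu : T \in unitmx by rewrite unitmxE unitfE -normr_eq0 dT oner_eq0.
have half : 0 < (2^-1 : R) < 1 by lra.
have [d1 d10 H1] := strict_deriv_vol Tu ST half.
have /nbhs_ballP[d2 /= d20 H2] := images_near_point emb xB.
have /nbhs_ballP[d3 /= d30 H3] := near_affine_dom cm fm.
pose d := Num.min d1 (Num.min d2 d3); have dp : 0 < d by rewrite !lt_min d10 d20.
have /and3P[dd1 dd2 dd3] : [&& d <= d1, d <= d2 & d <= d3] by rewrite !ge_min !lexx !orbT.
(* The cube of radius [r] centred at [x + 2 r e_0] stays within [3 r < d] of [x]. Its points have
   first coordinate above [x0], the radius of ball [i0], hence lie outside that ball. *)
pose r := d / 4%:R; have r0 : 0 < r by rewrite divr_gt0.
pose c := x + (2 * r) *: delta_mx 0 0.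
have cx : ball c r `<=` ball x d.
  move=> y /(cubeP _ _ r0) cy; apply/cubeP => // i.
  have := cy i; rewrite !mxE eqxx /=; case: (i == 0) => /=; rewrite ?mulr1 ?mulr0 ?addr0 !ltr_norml.
    by move=> /andP[]; rewrite /r; lra.
  by move=> /andP[]; rewrite /r; lra.
have cN y : ball c r y -> ~ closed_ball4 (delta 0 i0) y.
  move=> /(cubeP _ _ r0)/(_ 0); rewrite !mxE !eqxx !mulr1 ltr_norml => /andP[_ y1].
  move=> /(closed_ball4_coord 0); rewrite -x02 ler_sqr ?nnegrE ?(ltW x00)//; first last.
    by move: r0 x00; lra.
  by move: r0; lra.
pose F i y := darboux_chart m (f i y).
pose e := `|\det T| * ((1 - 2^-1) * r) ^+ 4.
have e0 : 0 < e by rewrite /e dT mul1r exprn_gt0// mulr_gt0//; lra.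
exists e => // t pt.
have ve : vol_ge (F i0 @` ball c r) e.
  by apply: H1 => // y /cx; apply: ballW.
have vi i : vol_ge (F i @` (closed_ball4 (delta 0 i) `&` dom_set m (f i))) (delta 0 i ^+ 2 * t).
  apply: (@ball_image_vol (f i) m (delta 0 i) t (d0 i) _ _ pt) => [y By|y z By Bz E]; first exact: fs By.
  by have [] := fi _ _ _ _ By Bz E.
apply: unit_ball_vol_ge; rewrite mulr_suml.
apply: (vol_ge_cat (S1 := \bigcup_i (F i @` (closed_ball4 (delta 0 i) `&` dom_set m (f i))))
  (S2 := F i0 @` ball c r)) ve.
- by move=> _ [i _ [y [_ Ay] <-]]; exact: darboux_chart_ball.
- by move=> _ [y cy <-]; apply/darboux_chart_ball/H3/(ballW dd3)/cx.
- rewrite -subset0 => _ [[i _ [z [Bz Az] <-]] [y cy E]].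
  have Ay : affine_dom m (f i0 y) by apply/H3/(ballW dd3)/cx.
  have fE := darboux_chart_inj Ay Az E.
  have [ii zy] := H2 y (ballW dd2 (cx _ cy)) i z Bz (esym fE).
  by apply: (cN y cy); rewrite -zy -ii.
apply: (@vol_ge_sum _ _ _ predT (fun i => F i @` (closed_ball4 (delta 0 i) `&` dom_set m (f i)))) => //.
- move=> i j _ _ ij; rewrite -subset0 => _ [[y [By Ay] <-] [z [Bz Az] E]].
  have fE := darboux_chart_inj Az Ay E.
  have [ji _] := fi _ _ _ _ Bz By fE.
  by rewrite ji eqxx in ij.
- by move=> i _ w Fw; exists i.
Qed.

Lemma admissible_sum_lt1 n (delta : 'rV[R]_n) : (0 < n)%N -> admissible delta ->
  \sum_i delta 0 i ^+ 2 < 1.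
Proof.
move=> n0 /(admissible_vol n0)[e e0 H]; rewrite ltNge; apply/negP => s1.
have [t pt] := sup_adherent e0 (@unit_ball_has_sup R); rewrite -/unit_ball_vol => et.
(* A nonnegative weight is needed for multiplication by a sum at least 1 to increase it. *)
have t0 : 0 <= Num.max t 0 by rewrite le_max lexx orbT.
have pm : packed (closed_ball4 1 : set 'rV[R]_4) (Num.max t 0).
  by case: (leP t 0) => _; [exact: packed0|].
have := H _ pm; have : Num.max t 0 <= (\sum_i delta 0 i ^+ 2) * Num.max t 0.
  by rewrite ler_peMl.
have : t <= Num.max t 0 by rewrite le_max lexx.
by move: et; lra.
Qed.

End Packings.

(** * Finiteness of the classes whose hyperplane passes near a point *)

Section Finiteness.
Context {R : realType} {n : nat}.
Implicit Types (delta : 'rV[R]_n) (A : H2 int n).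

Lemma cauchy_schwarz (a b : 'I_n -> R) :
  (\sum_i a i * b i) ^+ 2 <= (\sum_i a i ^+ 2) * (\sum_i b i ^+ 2).
Proof.
set X := \sum_i a i ^+ 2; set Y := \sum_i b i ^+ 2; set Z := \sum_i a i * b i.
have X0 : 0 <= X by apply: sumr_ge0 => i _; exact: sqr_ge0.
have h : 0 <= X * (X * Y - Z ^+ 2).
  have <- : \sum_i (X * b i - Z * a i) ^+ 2 = X * (X * Y - Z ^+ 2).
    rewrite (eq_bigr (fun i => X ^+ 2 * b i ^+ 2 - 2 * X * Z * (a i * b i) + Z ^+ 2 * a i ^+ 2)).
      by rewrite big_split sumrB -!mulr_sumr -/X -/Y -/Z /=; ring.
    by move=> i _; ring.
  by apply: sumr_ge0 => i _; exact: sqr_ge0.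
have [X00|X00] := eqVneq X 0; last by move: h; rewrite pmulr_rge0 ?lt_def ?X00// subr_ge0.
have a0 i : a i = 0.
  apply/eqP; rewrite -sqrf_eq0; apply/eqP; move: X00; rewrite /X => /psumr_eq0P; apply => // j _.
  exact: sqr_ge0.
by rewrite X00 mul0r /Z big1 ?expr0n// => i _; rewrite a0 mul0r.
Qed.

(* By Cauchy-Schwarz the line A^perp is negative definite near [omega_delta],
   and there the adjunction inequality bounds the coefficients of [A]. *)
Lemma calH_sumsq_bound delta A (q : R) : 0 < q -> \sum_i delta 0 i ^+ 2 <= 1 - q ->
  calH A -> @hyperplane R n A delta ->
  let M := 4%:R / q + n%:R / q ^+ 2 in
  A.1%:~R ^+ 2 <= M :> R /\ forall i, (A.2 0 i)%:~R ^+ 2 <= M :> R.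
Proof.
move=> q0 dq [A1 A2 _ adj] /= hyp.
pose a0 : R := A.1%:~R; pose a i : R := (A.2 0 i)%:~R.
have a00 : 0 <= a0 by rewrite ler0z.
have ai i : 0 <= a i by rewrite ler0z.
pose s := \sum_i a i ^+ 2; pose l := \sum_i a i.
have s0 : 0 <= s by apply: sumr_ge0 => i _; exact: sqr_ge0.
have a0E : a0 = \sum_i delta 0 i * a i.
  move: hyp; rewrite /hyperplane /= /intersection /= mul1r => /eqP; rewrite subr_eq0 => /eqP; rewrite -/a0 => ->.
  by apply: eq_bigr => i _; rewrite mxE.
have cs : a0 ^+ 2 <= (1 - q) * s.
  rewrite a0E; apply: le_trans (cauchy_schwarz _ _) _.
  by rewrite ler_wpM2r.
have adjR : - 2 <= a0 ^+ 2 - s - 3 * a0 + l.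
  have : ((- 2)%:~R : R) <= (intersection A A + intersection (canonical_class n) A)%:~R by rewrite ler_int.
  rewrite /intersection /= !(rmorphD, rmorphB, rmorphM, rmorphN) /=.
  rewrite !rmorph_sum /= => h; apply: le_trans h _.
  rewrite le_eqVlt; apply/orP; left; apply/eqP.
  rewrite (eq_bigr (fun i => a i ^+ 2)) => [|i _]; last by rewrite rmorphM.
  rewrite [X in _ + (_ - X)](eq_bigr (fun i => - a i)) => [|i _]; last by rewrite mxE mulN1r rmorphN.
  by rewrite sumrN -/s -/l -/a0; ring.
(* Termwise [a_i <= (q / 2) a_i ^+ 2 + 1 / (2 q)]; the weight [q / 2] lets half of the gain [q s]
   from Cauchy-Schwarz absorb the linear term. *)
have lb : l <= q / 2 * s + n%:R / (2 * q).
  have -> : n%:R / (2 * q) = \sum_(i < n) (2 * q)^-1.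
    by rewrite sumr_const card_ord mulr_natl.
  rewrite /s mulr_sumr -big_split /=; apply: ler_sum => i _.
  rewrite -subr_ge0 (_ : _ - _ = q / 2 * (a i - q^-1) ^+ 2); last by field; rewrite gt_eqF.
  by rewrite mulr_ge0 ?sqr_ge0// divr_ge0// ltW.
(* Adjunction and [cs] give [q s <= 2 + l] since [a0 >= 0]; with [lb] this becomes
   [(q / 2) s <= 2 + n / (2 q)], the origin of the bound. *)
have sM : s <= 4%:R / q + n%:R / q ^+ 2.
  have h : q / 2 * s <= 2 + n%:R / (2 * q).
    have : (1 - q) * s = s - q * s by ring.
    have : q * s = q / 2 * s + q / 2 * s by field.
    by move: cs adjR lb a00; lra.
  have q2 : 0 < q / 2 by rewrite divr_gt0.
  rewrite -(ler_pM2l q2); apply: le_trans h _.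
  by rewrite le_eqVlt; apply/orP; left; apply/eqP; field; rewrite gt_eqF.
split.
  rewrite -/a0; apply: le_trans sM; apply: le_trans cs _.
  by rewrite ler_piMl// gerBl ltW.
move=> i; apply: le_trans sM; rewrite -/(a i) /s (bigD1 i)//= lerDl.
by apply: sumr_ge0 => j _; exact: sqr_ge0.
Qed.

Lemma bounded_classes_finite (N : nat) : finite_set
  [set A : H2 int n | (0 <= A.1 < N%:Z) /\ forall i, 0 <= A.2 0 i < N%:Z].
Proof.
pose g (p : 'I_N * {ffun 'I_n -> 'I_N}) : H2 int n :=
  ((p.1 : nat)%:Z, \row_i (p.2 i : nat)%:Z).
apply: (@sub_finite_set _ _ (range g)); last exact/finite_image/finite_finset.
move=> [a0 a] /= [/andP[a00 a0N] aN].
have lt0 : (`|a0| < N)%N by rewrite -ltz_nat gez0_abs.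
have lt i : (`|a 0%R i| < N)%N by have /andP[h1 h2] := aN i; rewrite -ltz_nat gez0_abs.
exists (Ordinal lt0, [ffun i => Ordinal (lt i)]) => //.
rewrite /g /= gez0_abs//; congr (_, _); apply/rowP => i.
by rewrite mxE ffunE /= gez0_abs//; have /andP[] := aN i.
Qed.

Lemma calH_finite_near delta : \sum_i delta 0 i ^+ 2 < 1 ->
  exists2 V, nbhs delta V & finite_set [set A | calH A /\ @hyperplane R n A `&` V !=set0].
Proof.
(* Half of the gap to 1: the other half absorbs the variation of the sum of squares over the
   neighbourhood. *)
move=> d1; pose q := (1 - \sum_i delta 0 i ^+ 2) / 2.
have q0 : 0 < q by rewrite divr_gt0// subr_gt0.
exists [set x | \sum_i x 0 i ^+ 2 <= 1 - q].
  apply: filterS (sumsq_near delta q0) => x; rewrite ler_norml /= => /andP[_].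
  by rewrite /q; lra.
pose M := 4%:R / q + n%:R / q ^+ 2; pose N := (Num.bound M).+1.
have M0 : 0 <= M by apply: addr_ge0; apply: divr_ge0 => //; [exact: ltW|exact/exprn_ge0/ltW].
have small (k : int) : 0 <= k -> k%:~R ^+ 2 <= M :> R -> 0 <= k < N%:Z.
  move=> k0 kM; rewrite k0 /= ltNge; apply/negP => kN.
  have Nk : N%:R <= k%:~R :> R by rewrite -[N%:R]/(N%:Z%:~R) ler_int.
  have MN : M < N%:R by rewrite (lt_trans (archi_boundP M0))// ltr_nat.
  have N1 : 1 <= N%:R :> R by rewrite ler1n.
  have : k%:~R <= k%:~R ^+ 2 :> R by rewrite expr2 ler_peMl// (le_trans _ Nk).
  by move: kM MN Nk; lra.
apply: sub_finite_set (bounded_classes_finite N) => A /= [HA [x [Ax xq]]].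
have [b1 b2] := calH_sumsq_bound q0 xq HA Ax.
have [A1 A2 _ _] := HA; split; first exact: small.
by move=> i; apply: small.
Qed.

End Finiteness.

(** * Local finiteness and accumulation on the round boundary *)

Lemma closure_admissible (R : realType) (n : nat) (delta : 'rV[R]_n) : (0 < n)%N ->
  closure (@admissible R n) delta -> \sum_i delta 0 i ^+ 2 <= 1.
Proof.
move=> n0 cd; rewrite leNgt; apply/negP => d1.
have e0 : 0 < (\sum_i delta 0 i ^+ 2 - 1) / 2 by rewrite divr_gt0// subr_gt0.
have [x [/(admissible_sum_lt1 n0) x1]] := cd _ (sumsq_near delta e0).
by rewrite ler_norml => /andP[+ _]; move: d1 x1; lra.
Qed.

Theorem corollary5p12 (R : realType) (n : nat) (n_ge1 : (1 <= n)%N) :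
  locally_finite_in (@calH n) (@hyperplane R n) (@admissible R n) /\
  (forall delta : 'rV[R]_n,
     frontier (@admissible R n) delta ->
     accumulation_point [set @hyperplane R n A | A in @calH n] delta ->
     \sum_i delta 0 i ^+ 2 = 1 /\ symplectic_volume (omega_class delta) = 0).
Proof.
split=> [delta /(admissible_sum_lt1 n_ge1)/calH_finite_near //|delta [dC _] acc].
have d1 : \sum_i delta 0 i ^+ 2 = 1.
  apply/le_anti; rewrite (closure_admissible n_ge1 dC) leNgt; apply/negP.
  move=> /calH_finite_near[V Vd fV]; apply: (acc V Vd).
  (* Accumulation counts hyperplanes as sets whereas finiteness is known for classes, so the finite
     set of classes is pushed forward. *)
  apply: sub_finite_set (finite_image (@hyperplane R n) fV).
  by move=> _ [[A HA <-] AV]; exists A.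
split=> //; rewrite /symplectic_volume /intersection /= mulr1.
by rewrite (eq_bigr (fun i => delta 0 i ^+ 2)) ?d1 ?subrr ?mul0r// => i _; rewrite expr2.
Qed.
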